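(* Let $\mu,\lambda$ be constants with $\mu>0$ and $\nu:=2\mu+\lambda>0$, and let $\gamma>1$. Consider the one-dimensional isentropic compressible Navier–Stokes equations $$\rho_t+(\rho u)_x=0,\qquad (\rho u)_t+(\rho u^2+\rho^\gamma)_x=\nu u_{xx},\qquad (x,t)\in\mathbb{R}\times(0,T],$$ with initial data $(\rho,u)(x,0)=(\rho_0,u_0)(x)$, where $\rho_0,u_0$ are continuous, $\operatorname{supp}\rho_0=[0,1]$ and $\rho_0(x)>0$ for $x\in I:=(0,1)$. Suppose that the initial data satisfy one of the following two conditions: there exist positive numbers $\lambda_1,\lambda_2,\lambda_3,\lambda_4$ with $0<\lambda_3,\lambda_4<1$ such that either $$\frac{(\rho_0)_x}{\rho_0}\ge\lambda_1 \text{ in }(0,\lambda_3),\qquad u_0(\lambda_3)<0,\qquad u_0\le 0\text{ in }(0,\lambda_3),$$ or $$\frac{(\rho_0)_x}{\rho_0}\le-\lambda_2 \text{ in }(\lambda_4,1),\qquad u_0(\lambda_4)>0,\qquad u_0\ge 0\text{ in }(\lambda_4,1).$$ Then for every $T>0$ and every $m>2$, this Cauchy problem has no solution $(\rho,u)$ in $C^1([0,T];H^m(\mathbb{R}))$.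
   Context: $H^m(\mathbb{R})$ denotes the standard (inhomogeneous) $L^2$-based Sobolev space. The pressure law is $p=\rho^\gamma$. *)

(* Defs.v *)
From HB Require Import structures.
From mathcomp Require Import all_boot all_order all_algebra.
From mathcomp Require Import all_classical all_reals all_analysis.
Set Implicit Arguments. Unset Strict Implicit. Unset Printing Implicit Defensive.
Import Order.TTheory GRing.Theory Num.Theory.
Import numFieldNormedType.Exports.
Local Open Scope classical_set_scope.
Local Open Scope ring_scope.

Definition leb (R : realType) := (@lebesgue_measure R).

Definition test_fun (R : realType) (phi : R -> R) : Prop :=
  (forall (n : nat) (x : R), derivable (derive1n n phi) x 1) /\
  (exists A : R, forall x : R, A < `|x| -> phi x = 0).

Definition L2 (R : realType) (f : R -> R) : Prop :=
  measurable_fun setT f /\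
  (\int[@leb R]_x (((f x) ^+ 2)%:E) < +oo)%E.

Definition weak_deriv (R : realType) (f g : R -> R) : Prop :=
  forall phi : R -> R, test_fun phi ->
    (\int[@leb R]_x ((f x * derive1 phi x)%:E) =
     - \int[@leb R]_x ((g x * phi x)%:E))%E.

Definition gagliardo_sq (R : realType) (sigma : R) (g : R -> R) : \bar R :=
  (\int[@leb R]_x \int[@leb R]_y
     (((g x - g y) ^+ 2 / (`|x - y| `^ (1 + 2 * sigma)))%:E))%E.

(* Hm_sq_le m f c : f belongs to H^m(R) and its squared H^m norm is <= c.
   For k <= m < k+1 (k : nat), sigma := m - k, the squared norm is
   sum_{j<=k} ||f^{(j)}||_{L^2}^2 + [f^{(k)}]_{sigma}^2 (the last term only if
   sigma > 0), where f^{(j)} are weak derivatives. *)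
Definition Hm_sq_le (R : realType) (m : R) (f : R -> R) (c : R) : Prop :=
  exists (k : nat) (g : nat -> R -> R),
    [/\ (k%:R <= m) /\ (m < k.+1%:R),
        g 0%N = f,
        (forall j : nat, (j <= k)%N -> L2 (g j)),
        (forall j : nat, (j < k)%N -> weak_deriv (g j) (g j.+1)) &
        ((\sum_(0 <= j < k.+1) \int[@leb R]_x (((g j x) ^+ 2)%:E)) +
         (if m == k%:R then 0 else gagliardo_sq (m - k%:R) (g k)) <= c%:E)%E].

Definition in_Hm (R : realType) (m : R) (f : R -> R) : Prop :=
  exists c : R, Hm_sq_le m f c.

Definition C1_Hm (R : realType) (m T : R) (U : R -> R -> R) : Prop :=
  exists V : R -> R -> R,
    (forall t : R, 0 <= t <= T -> in_Hm m (U t) /\ in_Hm m (V t)) /\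
    (forall t : R, 0 <= t <= T -> forall eps : R, 0 < eps ->
       exists delta : R, 0 < delta /\
         forall s : R, 0 <= s <= T -> `|s - t| < delta ->
           [/\ Hm_sq_le m (fun x => U s x - U t x) eps,
               Hm_sq_le m (fun x => V s x - V t x) eps &
               (s != t -> Hm_sq_le m
                  (fun x => (U s x - U t x) / (s - t) - V t x) eps)]).

Definition CNS_solution (R : realType) (nu gamma T : R)
    (rho0 u0 : R -> R) (rho u : R -> R -> R) : Prop :=
  (forall x : R, rho 0 x = rho0 x /\ u 0 x = u0 x) /\
  (forall t x : R, 0 < t < T ->
     [/\ derivable (fun s => rho s x) t 1,
         derivable (fun y => rho t y * u t y) x 1,
         derivable (fun s => rho s x * u s x) t 1,
         derivable (fun y => rho t y * (u t y) ^+ 2 + rho t y `^ gamma) x 1 &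
         (forall y : R, derivable (u t) y 1)] /\
     [/\
         derivable (derive1 (u t)) x 1,
         derive1 (fun s => rho s x) t + derive1 (fun y => rho t y * u t y) x = 0 &
         derive1 (fun s => rho s x * u s x) t
           + derive1 (fun y => rho t y * (u t y) ^+ 2 + rho t y `^ gamma) x
         = nu * derive1 (derive1 (u t)) x]).

(* Main.v *)
Require Import Defs.
From HB Require Import structures.
From mathcomp Require Import all_boot all_order all_algebra.
From mathcomp Require Import all_classical all_reals all_analysis.
From mathcomp Require Import measurable_realfun ring lra.
Set Implicit Arguments. Unset Strict Implicit. Unset Printing Implicit Defensive.
Import Order.TTheory GRing.Theory Num.Theory.
Import numFieldNormedType.Exports.
Local Open Scope classical_set_scope.
Local Open Scope ring_scope.

(** The density vanishes outside [0, 1] and the momentum equation reads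
    [u_xx = 0] wherever the density does.  Since [u] is bounded and square
    integrable, it vanishes on the vacuum half-line to the left of the support;
    hence the support cannot move left and [u = u_x = 0] at [x = 0] for small
    times.  The lower bound on [rho_x / rho] survives for a short time, so that
    the pressure is nondecreasing near [x = 0] and [u] is a subsolution of a
    degenerate parabolic equation there.  Comparison with the barrier
    [- d (exp (M (x + s (t - tau))) - 1)] gives [u_x < 0] at [x = 0], a
    contradiction.  The second set of conditions reduces to the first by the
    reflection [x -> 1 - x].

    Of the [H^m] regularity only [H^2] is used: a function with two weak
    derivatives in [L^2] agrees almost everywhere with a bounded [C^1] function,
    its mollifications converging at Lebesgue points. *)

(** * Calculus on the line *)

Section Calculus.
Context {R : realType}.
Implicit Types f g p : R -> R.

(** The sign of the density has to come from the continuity equation alone, because the pressure is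
    the intended power only at nonnegative densities. Characteristics are never integrated. Each
    sign statement about the density is obtained from a continuous function on a compact space-time
    region, weighted by an exponential in time: it attains its minimum, and one short straight step
    backward in time, with velocities frozen at the minimum point, stays in the region and lowers a
    negative value. Since steps go backward, the minimum may lie at the final time. The barrier
    comparison uses the same compactness, with first and second order conditions in space and a
    one-sided condition in time. The two hypotheses on the velocity have separate roles. Strict
    negativity at the single point [lambda_3] persists for short times at a nearby point and
    controls the right edge of the barrier; the weak sign on the interval controls the initial time.
    The contradiction is reached on an arbitrarily short time interval, so every constant may be
    paid for by shrinking that interval. *)

Lemma is_derive_cstf (c x : R) : is_derive x 1 (fun=> c) (0 : R).
Proof. exact: is_derive_cst. Qed.

(** Expanded [fun y => ...] forms of the differentiation rules, from which derivatives of explicit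
    expressions are assembled as terms. *)
Lemma is_derive_addf f g (x a b : R) : is_derive x 1 f a -> is_derive x 1 g b ->
  is_derive x 1 (fun y => f y + g y) (a + b).
Proof. exact: is_deriveD. Qed.

Lemma is_derive_subf f g (x a b : R) : is_derive x 1 f a -> is_derive x 1 g b ->
  is_derive x 1 (fun y => f y - g y) (a - b).
Proof. exact: is_deriveB. Qed.

Lemma is_derive_oppf f (x a : R) : is_derive x 1 f a ->
  is_derive x 1 (fun y => - f y) (- a).
Proof. exact: is_deriveN. Qed.

Lemma is_derive_mulf f g (x a b : R) : is_derive x 1 f a -> is_derive x 1 g b ->
  is_derive x 1 (fun y => f y * g y) (a * g x + f x * b).
Proof.
move=> fa gb; have := is_deriveM fa gb; move/is_derive_eq; apply.
by rewrite /GRing.scale /= addrC [g x * a]mulrC.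
Qed.

Lemma is_derive_scalef (c : R) f (x a : R) : is_derive x 1 f a ->
  is_derive x 1 (fun y => c * f y) (c * a).
Proof.
move=> fa; apply: (is_derive_eq (is_derive_mulf (is_derive_cstf c x) fa)).
by rewrite mul0r add0r.
Qed.

Lemma is_derive_affine (a b x : R) : is_derive x 1 (fun y => a + b * y) b.
Proof.
apply: (is_derive_eq (is_derive_addf (is_derive_cstf a x)
  (is_derive_scalef b (is_derive_id x 1)))).
by rewrite add0r mulr1.
Qed.

Lemma is_derive_compf f g (x a b : R) : is_derive (g x) 1 f a ->
  is_derive x 1 g b -> is_derive x 1 (fun y => f (g y)) (a * b).
Proof. exact: is_derive1_comp. Qed.

Lemma is_derive_expf f (x a : R) : is_derive x 1 f a ->
  is_derive x 1 (fun y => expR (f y)) (expR (f x) * a).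
Proof. by move=> fa; exact: (is_derive_compf (is_derive_expR (f x)) fa). Qed.

Lemma is_derive_continuous f (x a : R) : is_derive x 1 f a ->
  {for x, continuous f}.
Proof.
by move=> [fx _]; apply: differentiable_continuous; exact/derivable1_diffP.
Qed.

Lemma is_derive_quotient f (x a : R) : is_derive x 1 f a ->
  h^-1 * (f (x + h) - f x) @[h --> 0^'] --> a.
Proof.
move=> [fx <-]; have := fx; rewrite /derivable /derive => h.
apply: cvg_trans h; apply: near_eq_cvg; near=> h => /=.
by rewrite /GRing.scale /= mulr1 [h + x]addrC.
Unshelve. all: by end_near. Qed.

Lemma quotient_is_derive f (x a : R) :
  h^-1 * (f (x + h) - f x) @[h --> 0^'] --> a -> is_derive x 1 f a.
Proof.
move=> h.
have h' : h^-1 *: ((f \o shift x) (h *: 1) - f x) @[h --> 0^'] --> a.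
  apply: cvg_trans h; apply: near_eq_cvg; near=> h => /=.
  by rewrite /GRing.scale /= mulr1 [h + x]addrC.
by split; [exact: (cvgP _ h')|exact: cvg_lim h'].
Unshelve. all: by end_near. Qed.

Lemma is_derive_lt0 p (d : R) : is_derive (0 : R) 1 p d -> d < 0 ->
  exists2 e, 0 < e & forall h, 0 < h < e -> p h < p 0.
Proof.
move=> /is_derive_quotient pd d0.
have := cvgr_lt _ pd _ d0.
move=> [e /= e0 He].
exists e => // h /andP[h0 he].
have : h^-1 * (p (0 + h) - p 0) < 0.
  by apply: He => /=; rewrite ?gt_eqF// /ball/= sub0r normrN gtr0_norm.
by rewrite add0r pmulr_rlt0 ?invr_gt0// subr_lt0.
Qed.

Lemma is_derive_gt0 p (x d : R) : is_derive x 1 p d -> 0 < d ->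
  exists2 e, 0 < e & forall h, 0 < h < e -> p (x - h) < p x /\ p x < p (x + h).
Proof.
move=> /is_derive_quotient pd d0.
have := cvgr_gt _ pd _ d0.
move=> [e /= e0 He].
exists e => // h /andP[h0 he]; split.
  have : 0 < (- h)^-1 * (p (x - h) - p x).
    by apply: He => /=; rewrite ?oppr_eq0 ?gt_eqF// /ball/= sub0r opprK gtr0_norm.
  by rewrite invrN mulNr oppr_gt0 pmulr_rlt0 ?invr_gt0// subr_lt0.
have : 0 < h^-1 * (p (x + h) - p x).
  by apply: He => /=; rewrite ?gt_eqF// /ball/= sub0r normrN gtr0_norm.
by rewrite pmulr_rgt0 ?invr_gt0// subr_gt0.
Qed.

Lemma mean_value f (df : R -> R) (a b : R) : a < b ->
  (forall x : R, is_derive x 1 f (df x)) ->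
  exists2 c, a < c < b & f b - f a = df c * (b - a).
Proof.
move=> ab fdf.
have [|c cab ->] := MVT ab (fun x _ => fdf x); last by exists c.
by apply: continuous_subspaceT => x; exact: is_derive_continuous (fdf x).
Qed.

(** The second derivative is required at [x] only: were it positive, [df] would be positive just to
    the right of its zero [x], and the mean value theorem would give a larger value of [f] there. *)
Lemma is_derive_local_max f (df : R -> R) (x d e : R) :
  (forall y : R, is_derive y 1 f (df y)) -> is_derive x 1 df d -> 0 < e ->
  (forall y, `|y - x| < e -> f y <= f x) -> df x = 0 /\ d <= 0.
Proof.
move=> fdf dfd e0 fmax.
have sl : df x = 0.
  apply/eqP; case: ltgtP => // h.
    have /is_derive_gt0/(_ _)[|e' e'0 He] := is_derive_oppf (fdf x).
      by rewrite oppr_gt0.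
    have [|+ _] := He (Num.min (e / 2) (e' / 2)).
      by rewrite lt_min gt_min !divr_gt0//= orbC ltr_pdivrMr// ltr_pMr// ltr1n.
    rewrite ltrN2 ltNge fmax// distrC opprB addrC subrK gtr0_norm.
      by rewrite gt_min ltr_pdivrMr// ltr_pMr// ltr1n.
    by rewrite lt_min !divr_gt0.
  have [//|e' e'0 He] := is_derive_gt0 (fdf x).
  have [|_] := He (Num.min (e / 2) (e' / 2)).
    by rewrite lt_min gt_min !divr_gt0//= orbC ltr_pdivrMr// ltr_pMr// ltr1n.
  rewrite ltNge fmax// addrC addKr gtr0_norm.
    by rewrite gt_min ltr_pdivrMr// ltr_pMr// ltr1n.
  by rewrite lt_min !divr_gt0.
split=> //; rewrite leNgt; apply/negP => d0.
have [e' e'0 He] := is_derive_gt0 dfd d0.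
pose k := Num.min (e / 2) (e' / 2).
have k0 : 0 < k by rewrite lt_min !divr_gt0.
have ke : k < e by rewrite gt_min ltr_pdivrMr// ltr_pMr// ltr1n.
have ke' : k < e' by rewrite gt_min orbC ltr_pdivrMr// ltr_pMr// ltr1n.
have [c /andP[xc cx] Hc] : exists2 c, x < c < x + k &
    f (x + k) - f x = df c * (x + k - x).
  by apply: mean_value => //; rewrite ltrDl.
have [|_] := He (c - x); first by rewrite subr_gt0 xc/= (lt_trans _ ke')// ltrBlDl.
rewrite sl addrC subrK => dc.
have : 0 < f (x + k) - f x by rewrite Hc mulr_gt0// addrC addKr.
by rewrite subr_gt0 ltNge fmax// addrC addKr gtr0_norm.
Qed.

Lemma lipschitz_of_derive f (df : R -> R) (K : R) :
  (forall x : R, is_derive x 1 f (df x)) -> (forall x, `|df x| <= K) ->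
  forall x y, `|f y - f x| <= K * `|y - x|.
Proof.
move=> fdf dfK.
have H x y : x < y -> `|f y - f x| <= K * `|y - x|.
  move=> xy; have [c _ ->] := mean_value xy fdf.
  by rewrite normrM ler_wpM2r.
move=> x y; case: (ltgtP x y) => [/H//|/H|->]; last by rewrite !subrr normr0 mulr0.
by rewrite distrC [`|x - y|]distrC.
Qed.

(** The minimum principle behind every comparison below: the minimum over [D] is attained, and a
    negative one could be lowered. *)
Lemma compact_nonneg (T : topologicalType) (D : set T) (G : T -> R) :
  compact D -> continuous G ->
  (forall z, D z -> G z < 0 -> exists2 z', D z' & G z' < G z) ->
  forall z, D z -> 0 <= G z.
Proof.
move=> cD cG H z Dz.
have [||c /set_mem Dc cmin] := @compact_EVT_min _ _ G _ _ cD.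
- by exists z.
- exact: continuous_subspaceT.
rewrite (le_trans _ (cmin _ (mem_set Dz)))// leNgt; apply/negP => /(H _ Dc)[z' Dz'].
by rewrite ltNge cmin// mem_set.
Qed.

Lemma closed_le_fun (T : topologicalType) (F G : T -> R) :
  continuous F -> continuous G -> closed [set z | F z <= G z].
Proof.
move=> cF cG.
rewrite (_ : [set z | _] = (fun z => G z - F z) @^-1` [set x | 0 <= x]); last first.
  by apply/seteqP; split => z /=; rewrite subr_ge0.
apply: closed_comp; last exact: closed_ge.
by move=> z _; apply: continuousB; [exact: cG|exact: cF].
Qed.

End Calculus.

Lemma derivable_is_derive {R : realType} (f : R -> R) (x : R) :
  derivable f x 1 -> is_derive x 1 f (derive1 f x).
Proof. by move=> /derivableP; rewrite derive1E. Qed.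

Lemma is_derive_derive1 {R : realType} (f : R -> R) (x a : R) :
  is_derive x 1 f a -> derive1 f x = a.
Proof. by move=> fa; rewrite derive1E derive_val. Qed.

Lemma le0_of_le_scale {R : realType} (a B : R) :
  (forall e, 0 < e -> a <= B * e) -> a <= 0.
Proof.
move=> H; rewrite leNgt; apply/negP => a0.
have B1 : 0 < `|B| + 1 by rewrite ltr_wpDl.
have := H (a / (`|B| + 1) / 2); rewrite !divr_gt0// => /(_ isT).
have := ler_norm B; set e := a / _ / 2 => BB ale.
have ae : a = e * 2 * (`|B| + 1) by rewrite /e divfK// divfK// gt_eqF.
have e0 : 0 < e by rewrite !divr_gt0.
nra.
Qed.

(** * Transport along characteristics *)

Section Fields.
Context {R : realType}.
Implicit Types F Fx Ft w wx wt r rx rt u ux ut : R -> R -> R.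

(** Directional derivatives in space-time are required at interior times only: a field given on
    [[0, tau]] is extended by constants in time, which keeps continuity and space derivatives on the
    whole plane but not time derivatives at the ends. [field_dir] is what differentiation along
    lines tangent to characteristics needs. *)
Record C1_field F Fx Ft (B tau : R) : Prop := C1Field {
  field_continuous : continuous (fun z : R * R => F z.1 z.2);
  field_dx : forall t x : R, is_derive x 1 (F t) (Fx t x);
  field_dir : forall t x a b : R, 0 < t < tau ->
    is_derive (0 : R) 1 (fun h : R => F (t + a * h) (x + b * h))
      (a * Ft t x + b * Fx t x);
  field_bound : forall t x, 0 <= t <= tau ->
    [/\ `|F t x| <= B, `|Fx t x| <= B & `|Ft t x| <= B] }.

Lemma field_dt F Fx Ft (B tau t x : R) : C1_field F Fx Ft B tau -> 0 < t < tau ->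
  is_derive t 1 (fun s => F s x) (Ft t x).
Proof.
move=> fF tI; have H := field_dir fF x 1 0 tI.
pose p h := F (t + 1 * h) (x + 0 * h).
have H' : is_derive (- t + 1 * t) 1 p (1 * Ft t x + 0 * Fx t x).
  by rewrite [- t + _](_ : _ = 0); [exact: H|ring].
have := @is_derive_compf _ p (fun s => - t + 1 * s) t _ _ H' (is_derive_affine (- t) 1 t).
rewrite (_ : (fun s => p (- t + 1 * s)) = (fun s => F s x)).
  by move/is_derive_eq; apply; ring.
by apply/funext => s; rewrite /p; congr (F _ _); ring.
Qed.

Lemma continuous_field (X : topologicalType) F (a b : X -> R) :
  continuous (fun z : R * R => F z.1 z.2) -> continuous a -> continuous b ->
  continuous (fun z => F (a z) (b z)).
Proof.
move=> cF ca cb z.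
have cab : {for z, continuous (fun z => (a z, b z))}.
  exact: (cvg_pair (ca z) (cb z)).
exact: (continuous_comp cab (cF (a z, b z))).
Qed.

(** Here [g] is the distance to an edge of the region and [c] the rate at which a backward step
    consumes it; the step stays inside if the rate is nonpositive when no distance is left. *)
Lemma edge_room (g c : R) : 0 <= g -> (g = 0 -> c <= 0) ->
  exists2 e, 0 < e & forall h, 0 < h < e -> c * h <= g.
Proof.
rewrite le_eqVlt => /orP[/eqP <- /(_ erefl) c0|g0 _].
  exists 1 => // h /andP[h0 _]; nra.
exists (g / (`|c| + 1)); first by rewrite divr_gt0// ltr_wpDl.
move=> h /andP[h0]; rewrite ltr_pdivlMr ?ltr_wpDl// => hg.
have := ler_norm c; nra.
Qed.

Lemma compact_trapezoid (tau l0 b1 l1 b2 : R) : compact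
  [set z : R * R | 0 <= z.1 <= tau /\ l0 + b1 * z.1 <= z.2 <= l1 - b2 * z.1].
Proof.
(* The slanted inequalities are closed conditions; the box, which they imply for times in
   [[0, tau]], supplies compactness. *)
pose K := [set z : R * R | l0 + b1 * z.1 <= z.2] `&`
          [set z : R * R | z.2 <= l1 - b2 * z.1] `&`
  (`[0, tau]%classic `*` `[l0 - `|b1| * tau, l1 + `|b2| * tau]%classic).
have c1 : continuous (fst : R * R -> R) by move=> z; exact: cvg_fst.
have c2 : continuous (snd : R * R -> R) by move=> z; exact: cvg_snd.
have caff (a b : R) : continuous (fun z : R * R => a + b * z.1).
  by move=> z; apply: cvgD; [exact: cvg_cst|apply: cvgM; [exact: cvg_cst|exact: c1]].
rewrite (_ : [set z | _] = K); last first.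
  apply/seteqP; split => -[t x] /=; last first.
    by move=> [[h1 h2] /= []]; rewrite /= !in_itv/= => h3 h4; split => //; apply/andP.
  move=> [/andP[t0 tT] /andP[h1 h2]]; rewrite /K /=; split; first by split.
  split; rewrite /= in_itv/=; first by rewrite t0.
  have := ler_norm b1; have := ler_norm b2; have := ler_norm (- b1).
  have := ler_norm (- b2); rewrite !normrN => ? ? ? ?; apply/andP; split; nra.
rewrite /K setIC; apply: (@subclosed_compact _ _ (`[0, tau]%classic `*`
    `[l0 - `|b1| * tau, l1 + `|b2| * tau]%classic)).
- apply: closedI; last first.
    apply: closedI; apply: closed_le_fun => //.
    rewrite (_ : (fun z : R * R => _) = (fun z : R * R => l1 + (- b2) * z.1)) //.
    by apply/funext => z; rewrite mulNr.
  apply: compact_closed; last by apply: compact_setX; exact: segment_compact.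
  exact: norm_hausdorff.
- by apply: compact_setX; exact: segment_compact.
- by move=> z [].
Qed.

(* Along the backward characteristic through a negative minimum of
   [exp (- a t) w], that function would decrease further. *)
Lemma transport_nonneg w wx wt u ux (B tau0 tau l0 b1 l1 b2 : R) :
  C1_field w wx wt B tau0 -> tau < tau0 ->
  (forall t x, 0 < t < tau0 -> `|ux t x| <= B) ->
  (forall t x, 0 < t < tau0 -> wt t x + u t x * wx t x + w t x * ux t x = 0) ->
  (forall t, 0 < t <= tau -> u t (l0 + b1 * t) <= b1) ->
  (forall t, 0 < t <= tau -> - u t (l1 - b2 * t) <= b2) ->
  (forall x, l0 <= x <= l1 -> 0 <= w 0 x) ->
  forall t x, 0 <= t <= tau -> l0 + b1 * t <= x <= l1 - b2 * t -> 0 <= w t x.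
Proof.
move=> wf tt uxB eqw left right w0.
(* Along a characteristic [w] grows at rate [- ux], with [|ux| <= B]; the weight with rate [B + 1]
   makes the product strictly increasing in time wherever [w < 0]. *)
pose G := fun z : R * R => expR (- (B + 1) * z.1) * w z.1 z.2.
have cG : continuous G.
  move=> z; apply: cvgM; last exact: (field_continuous wf).
  apply: continuous_comp; last exact: continuous_expR.
  by apply: cvgM; [exact: cvg_cst|exact: cvg_fst].
move=> t x tT xI.
have := compact_nonneg (@compact_trapezoid tau l0 b1 l1 b2) cG _ (z := (t, x)).
rewrite /G/= pmulr_rge0 ?expR_gt0//; apply => // -[{t tT xI}t {}x] /=.
move=> [/andP[t0 tT] /andP[xl xr]].
rewrite pmulr_rlt0 ?expR_gt0// => wneg.
have {}t0 : 0 < t.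
  rewrite lt_neqAle t0 andbT; apply/negP => /eqP t0'.
  move: wneg; rewrite -t0' ltNge w0//.
  by move: xl xr; rewrite -t0' !mulr0 subr0 addr0 => -> ->.
have tI : 0 < t < tau0 by rewrite t0 (le_lt_trans tT).
(* A straight line with the velocity at [(t, x)] replaces the characteristic: only its tangent at
   [h = 0] matters. *)
pose p := fun h : R => expR (- (B + 1) * (t + (-1) * h)) *
  w (t + (-1) * h) (x + (- u t x) * h).
have pd : is_derive (0 : R) 1 p (expR (- (B + 1) * t) *
    ((B + 1) * w t x - (wt t x + u t x * wx t x))).
  refine (is_derive_eq (is_derive_mulf (is_derive_expf (is_derive_scalef
    (- (B + 1)) (is_derive_affine t (-1) 0))) (field_dir wf x (-1) (- u t x) tI)) _).
  by rewrite !mulr0 !addr0; ring.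
have [|e e0 He] := is_derive_lt0 pd.
  rewrite pmulr_rlt0 ?expR_gt0//.
  have := eqw t x tI; have := uxB t x tI; rewrite ler_norml => /andP[? ?]; nra.
have [| |e1 e10 He1] := @edge_room (x - l0 - b1 * t) (u t x - b1).
- by rewrite -addrA -opprD subr_ge0.
- move=> h; rewrite subr_le0.
  have -> : x = l0 + b1 * t by move: h; lra.
  by apply: left; rewrite t0.
have [| |e2 e20 He2] := @edge_room (l1 - b2 * t - x) (- u t x - b2).
- by rewrite subr_ge0.
- move=> h; rewrite subr_le0.
  have -> : x = l1 - b2 * t by move: h; lra.
  by apply: right; rewrite t0.
pose h := Num.min t (Num.min e (Num.min e1 e2)) / 2.
have hm : 0 < Num.min t (Num.min e (Num.min e1 e2)) by rewrite !lt_min t0 e0 e10.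
have h0 : 0 < h by rewrite divr_gt0.
have : h < Num.min t (Num.min e (Num.min e1 e2)).
  by rewrite ltr_pdivrMr// ltr_pMr// ltr1n.
rewrite !lt_min => /and4P[ht he he1 he2].
exists (t + (-1) * h, x + (- u t x) * h) => /=.
  have := He1 h; have := He2 h; rewrite h0 he1 he2 => /(_ isT) ? /(_ isT) ?.
  by split; apply/andP; split; lra.
have := He h; rewrite h0 he => /(_ isT); rewrite /p !mulr0 !addr0; exact.
Qed.

Lemma C1_fieldN F Fx Ft (B tau : R) : C1_field F Fx Ft B tau ->
  C1_field (fun t x => - F t x) (fun t x => - Fx t x) (fun t x => - Ft t x) B tau.
Proof.
case=> cF dF dirF bF; split.
- by move=> z; apply: cvgN; exact: cF.
- by move=> t x; exact: is_derive_oppf.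
- move=> t x a b tI; apply: (is_derive_eq (is_derive_oppf (dirF t x a b tI))).
  by ring.
- by move=> t x tI; rewrite !normrN; exact: bF.
Qed.

End Fields.

(** * Vacuum, monotonicity and the boundary point lemma *)

Section Flow.
Context {R : realType}.
Variables (r rx rt u ux ut : R -> R -> R) (B T nu gamma : R).
Hypothesis nu0 : 0 < nu.
Hypothesis gamma1 : 1 < gamma.
Hypothesis r_field : C1_field r rx rt B T.
Hypothesis u_field : C1_field u ux ut B T.
Hypothesis continuity_eq : forall t x, 0 < t < T ->
  rt t x + u t x * rx t x + r t x * ux t x = 0.
Hypothesis momentum_eq : (forall t x, 0 <= t < T -> 0 <= r t x) ->
  forall t x, 0 < t < T ->
  [/\ derivable (fun y => r t y `^ gamma) x 1, derivable (ux t) x 1 &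
    r t x * ut t x + r t x * u t x * ux t x + derive1 (fun y => r t y `^ gamma) x
    = nu * derive1 (ux t) x].
Hypothesis velocity_decay : forall t a c, 0 < t < T ->
  (forall x, x < a -> u t x = c) -> c = 0.
Hypothesis r0_ge0 : forall x, 0 <= r 0 x.
Hypothesis r0_eq0 : forall x, x <= 0 -> r 0 x = 0.

Let ub t x : 0 < t < T -> [/\ - B <= u t x, u t x <= B, - B <= ux t x,
  ux t x <= B & `|ut t x| <= B].
Proof.
move=> /andP[t0 tT]; have [] := field_bound u_field (t := t) x.
  by rewrite !ltW.
by rewrite !(ler_norml (_ t x) B) => /andP[? ?] /andP[? ?] utB.
Qed.

Let rb t x : 0 <= t < T -> [/\ r t x <= B, `|rx t x| <= B & `|rt t x| <= B].
Proof.
move=> /andP[t0 tT]; have [] := field_bound r_field (t := t) x.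
  by rewrite t0 ltW.
by move=> /(le_trans (ler_norm _)).
Qed.

Let uxB t x : 0 < t < T -> `|ux t x| <= B.
Proof. by move=> /(@ub _ x)[_ _ ? ? _]; rewrite ler_norml; apply/andP. Qed.

Let u_lip t x y : 0 < t < T -> `|u t y - u t x| <= B * `|y - x|.
Proof.
move=> tI; apply: (@lipschitz_of_derive _ _ (ux t)); last by move=> z; exact: uxB.
exact: (field_dx u_field).
Qed.

Let r_lip t x y : 0 <= t < T -> `|r t y - r t x| <= B * `|y - x|.
Proof.
move=> tI; apply: (@lipschitz_of_derive _ _ (rx t)); last first.
  by move=> z; have [] := rb z tI.
exact: (field_dx r_field).
Qed.

(** Transport on the backward triangle with apex [(t, x)] and sides of speed [B >= |u|], which no
    backward characteristic leaves. Only the continuity equation enters, so the conditional momentum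
    equation becomes available afterwards. *)
Lemma density_ge0 t x : 0 <= t < T -> 0 <= r t x.
Proof.
move=> /andP[t0 tT].
apply: (@transport_nonneg _ r rx rt u ux B T t (x - B * t) B (x + B * t) B) => //.
- move=> s /andP[s0 st]; have [] := @ub s (x - B * t + B * s) => //.
  by rewrite s0 (le_lt_trans st).
- move=> s /andP[s0 st]; have [|? _ _ _ _] := @ub s (x + B * t - B * s).
    by rewrite s0 (le_lt_trans st).
  by lra.
- by rewrite t0 lexx.
- by apply/andP; split; lra.
Qed.

Let momentum t x (tI : 0 < t < T) := momentum_eq density_ge0 x tI.

Lemma vacuum_at_rest t a : 0 < t < T -> (forall x, x <= a -> r t x = 0) ->
  forall x, x <= a -> u t x = 0.
Proof.
move=> tI ra.
(* Strict inequality leaves a neighbourhood of [x] in the vacuum, on which the pressure is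
   identically zero. *)
have duxa x : x < a -> derive1 (ux t) x = 0.
  move=> xa; have [_ _] := momentum x tI.
  rewrite ra ?ltW// !mul0r !add0r.
  have -> : derive1 (fun y => r t y `^ gamma) x = 0.
    apply: is_derive_derive1.
    have : is_derive x 1 (fun=> 0) (0 : R) by exact: is_derive_cstf.
    apply: near_eq_is_derive; near=> y; rewrite ra ?powR0 ?gt_eqF ?(lt_trans _ gamma1)// ltW//.
    by near: y; exact: lt_nbhsl.
  by move=> /esym/eqP; rewrite mulf_eq0 gt_eqF//= => /eqP.
have uxc x y : x < y -> y < a -> ux t y = ux t x.
  move=> xy ya.
  have [|c /andP[xc cy] /eqP] := @mean_value _ (ux t) (derive1 (ux t)) x y xy.
    by move=> z; apply: derivable_is_derive; have [] := momentum z tI.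
  by rewrite duxa ?(lt_trans cy)// mul0r subr_eq0 => /eqP.
(* [u] is affine on the half-line; its slope, read off on an interval of length [1 / e], is at most
   [2 B e]. *)
have ux0 x : x < a -> ux t x = 0.
  move=> xa; apply/eqP; rewrite -normr_eq0 eq_le normr_ge0 andbT.
  apply: (@le0_of_le_scale _ _ (2 * B)) => e e0.
  have xe : x - e^-1 < x by rewrite ltrBlDr ltrDl invr_gt0.
  have [c /andP[ec cx]] := mean_value xe (field_dx u_field t).
  rewrite -(uxc c x cx xa) => /(congr1 Num.norm).
  have -> : x - (x - e^-1) = e^-1 by ring.
  rewrite normrM [`|e^-1|]gtr0_norm ?invr_gt0//.
  move=> E; have -> : `|ux t x| = `|u t x - u t (x - e^-1)| * e.
    by rewrite E divfK// gt_eqF.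
  apply: ler_wpM2r; first exact: ltW.
  have [? ? _ _ _] := ub x tI; have [? ? _ _ _] := ub (x - e^-1) tI.
  by rewrite ler_norml; apply/andP; split; lra.
have uc x y : x < y -> y < a -> u t y = u t x.
  move=> xy ya; have [c /andP[xc cy] /eqP] := mean_value xy (field_dx u_field t).
  by rewrite ux0 ?(lt_trans cy)// mul0r subr_eq0 => /eqP.
have u0 x : x < a -> u t x = 0.
  move=> xa; apply: (velocity_decay (a := x) tI) => y yx.
  by rewrite (uc y x).
move=> x xa; apply/eqP; rewrite -normr_eq0 eq_le normr_ge0 andbT.
apply: (@le0_of_le_scale _ _ B) => e e0.
have := u_lip (x - e) x tI.
have -> : x - (x - e) = e by ring.
by rewrite (u0 (x - e)) ?subr0 ?(gtr0_norm e0)//; lra.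
Unshelve. all: by end_near. Qed.

(* Halving the speed of the known vacuum region: at [x = - th t / 2] one has
   [|u| <= B th t / 2 <= th / 2], as [u] vanishes for [x <= - th t]. *)
Lemma vacuum_step tau th : tau < T -> B * tau <= 1 -> 0 <= th ->
  (forall t x, 0 <= t <= tau -> x <= - (th * t) -> r t x = 0) ->
  forall t x, 0 <= t <= tau -> x <= - (th / 2 * t) -> r t x = 0.
Proof.
move=> tT Btau th0 rth t x tI xt.
have tI' : 0 <= t < T by case/andP: tI => -> /= /le_lt_trans; exact.
apply/eqP; rewrite eq_le density_ge0// andbT -oppr_ge0.
(* The equation is linear in the density, so it passes to [- r], whose nonnegativity is the missing
   half. The left side moves at speed [B]; the right side is the new vacuum boundary. *)
apply: (@transport_nonneg _ _ _ _ u ux B T tau (x - B * t) B 0 (th / 2)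
  (C1_fieldN r_field)) => //.
- by move=> s y sI; have := continuity_eq y sI; lra.
- move=> s /andP[s0 st]; have [] := @ub s (x - B * t + B * s) => //.
  by rewrite s0 (le_lt_trans st).
- move=> s /andP[s0 st].
  have sI : 0 < s < T by rewrite s0 (le_lt_trans st).
  have rs y : y <= - (th * s) -> r s y = 0 by apply: rth; rewrite ltW.
  have us := vacuum_at_rest sI rs (lexx _).
  have := u_lip (- (th * s)) (0 - th / 2 * s) sI; rewrite us subr0.
  have -> : 0 - th / 2 * s - - (th * s) = th * s / 2 by lra.
  have := ler_norm (- u s (0 - th / 2 * s)).
  have ths : 0 <= th * s / 2 by rewrite divr_ge0// mulr_ge0// ltW.
  rewrite normrN (ger0_norm ths) => h1 h2.
  apply: (le_trans (le_trans h1 h2)).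
  have : B * s <= 1.
    have [B0|B0] := leP 0 B; last by nra.
    by rewrite (le_trans _ Btau)// ler_wpM2l.
  by nra.
- by move=> y /andP[_ y0]; rewrite r0_eq0// oppr0.
- by apply/andP; split; lra.
Qed.

(** The support spreads at speed at most [B]; halving this speed indefinitely gives vacuum for
    [x < 0], and the Lipschitz bound in space carries it to [x = 0]. *)
Lemma vacuum_left tau : tau < T -> B * tau <= 1 ->
  forall t x, 0 <= t <= tau -> x <= 0 -> r t x = 0.
Proof.
move=> tT Btau t x tI x0.
have tI' : 0 <= t < T by case/andP: tI => -> /= /le_lt_trans; exact.
have B0 : 0 <= B by have [_ + _] := rb x tI'; exact: le_trans (normr_ge0 _).
have H n : forall t x, 0 <= t <= tau -> x <= - (B / 2 ^+ n * t) -> r t x = 0.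
  elim: n => [|n IH]; last first.
    move=> s y sI; rewrite exprSr invfM mulrA; apply: vacuum_step IH _ _ sI => //.
    by rewrite divr_ge0// exprn_ge0.
  move=> s y sI; rewrite expr0 divr1 => ys.
  have sI' : 0 <= s < T by case/andP: sI => -> /= /le_lt_trans; exact.
  apply/eqP; rewrite eq_le density_ge0// andbT -oppr_ge0.
  apply: (@transport_nonneg _ _ _ _ u ux B T tau (y - B * s) B 0 B
    (C1_fieldN r_field)) => //.
  - by move=> a b aI; have := continuity_eq b aI; lra.
  - move=> a /andP[a0 aT]; have [] := @ub a (y - B * s + B * a) => //.
    by rewrite a0 (le_lt_trans aT).
  - move=> a /andP[a0 aT]; have [|? _ _ _ _] := @ub a (0 - B * a).
      by rewrite a0 (le_lt_trans aT).
    by lra.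
  - by move=> b /andP[_ b0]; rewrite r0_eq0// oppr0.
  - by apply/andP; split; lra.
apply/eqP; rewrite -normr_eq0 eq_le normr_ge0 andbT.
apply: (@le0_of_le_scale _ _ B) => e e0.
(* With this [n] the vacuum boundary has moved by at most [e], so [x - e] is in the vacuum. *)
have [n ne] : exists n : nat, B * t / e < 2 ^+ n.
  exists (Num.bound (B * t / e)).
  apply: lt_trans (archi_boundP _) _.
    by rewrite divr_ge0 ?mulr_ge0 ?(ltW e0)//; case/andP: tI.
  by rewrite -natrX ltr_nat ltn_expl.
have := r_lip (x - e) x tI'.
have -> : x - (x - e) = e by ring.
rewrite (H n t (x - e) tI) ?subr0 ?(gtr0_norm e0)//.
have p2 : 0 < 2 ^+ n :> R by rewrite exprn_gt0.
suff : B / 2 ^+ n * t <= e by lra.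
by rewrite mulrAC ler_pdivrMr// [e * _]mulrC -ler_pdivrMr// ltW.
Qed.

Lemma velocity_left tau : tau < T -> B * tau <= 1 ->
  forall t x, 0 < t <= tau -> x <= 0 -> u t x = 0.
Proof.
move=> tT Btau t x /andP[t0 tt] x0.
apply: (@vacuum_at_rest t 0) => //; first by rewrite t0 (le_lt_trans tt).
by move=> y y0; apply: (vacuum_left tT Btau) => //; rewrite ltW.
Qed.

(** The chain rule applies where the density is positive. Where it vanishes the pressure is at its
    minimum, so its derivative, which exists by the momentum equation, is zero. *)
Lemma pressure_dx_bound t x : 0 < t < T ->
  `|derive1 (fun y => r t y `^ gamma) x| <= gamma * B `^ (gamma - 1) * B.
Proof.
move=> tI; have [/derivable_is_derive dp _ _] := momentum x tI.
have tI' : 0 <= t < T by case/andP: tI => /ltW -> ->.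
have [rB rxB _] := rb x tI'.
have B0 : 0 <= B by apply: le_trans rxB.
have g0 : 0 <= gamma by rewrite ltW// (lt_trans _ gamma1).
have [r0|r0|r0] := ltgtP (r t x) 0.
- by have := density_ge0 x tI'; rewrite leNgt r0.
- have := is_derive_compf (is_derive1_powR gamma r0) (field_dx r_field t x).
  move=> /is_derive_derive1 ->.
  rewrite !normrM (ger0_norm g0) ger0_norm ?powR_ge0//.
  apply: ler_pM => //; first by rewrite mulr_ge0// powR_ge0.
  have g1 : 0 <= gamma - 1 by rewrite subr_ge0 ltW.
  by rewrite ler_wpM2l// ge0_ler_powR// nnegrE ltW.
- suff -> : derive1 (fun y => r t y `^ gamma) x = 0.
    by rewrite normr0 !mulr_ge0// powR_ge0.
  have px : r t x `^ gamma = 0 by rewrite r0 powR0// gt_eqF// (lt_trans _ gamma1).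
  apply/eqP; case: ltgtP => // h.
    have [|e e0 He] := is_derive_gt0 (is_derive_oppf dp); first by rewrite oppr_gt0.
    have [|_] := He (e / 2); first by rewrite divr_gt0//= ltr_pdivrMr// ltr_pMr// ltr1n.
    by rewrite ltrN2 px ltNge powR_ge0.
  have [e e0 He] := is_derive_gt0 dp h.
  have [|+ _] := He (e / 2); first by rewrite divr_gt0//= ltr_pdivrMr// ltr_pMr// ltr1n.
  by rewrite px ltNge powR_ge0.
Qed.

(** [H^2] alone makes [ux] only Hölder continuous. The momentum equation bounds [uxx] pointwise, all
    its other terms being bounded. *)
Lemma velocity_dx_lipschitz : exists K, forall t x y, 0 < t < T ->
  `|ux t y - ux t x| <= K * `|y - x|.
Proof.
exists ((B * B + B * B * B + gamma * B `^ (gamma - 1) * B) / nu) => t x y tI.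
apply: (@lipschitz_of_derive _ _ (derive1 (ux t))) => z.
  by apply: derivable_is_derive; have [] := momentum z tI.
have [_ _ E] := momentum z tI; have := pressure_dx_bound z tI.
have tI' : 0 <= t < T by case/andP: tI => /ltW -> ->.
rewrite ler_pdivlMr// => pB.
have -> : `|derive1 (ux t) z| * nu = `|nu * derive1 (ux t) z|.
  by rewrite normrM (gtr0_norm nu0) mulrC.
rewrite -E.
have [] := field_bound u_field (t := t) z; first by case/andP: tI => /ltW -> /ltW.
have [rB _ _] := rb z tI'; have {}rB : `|r t z| <= B by rewrite ger0_norm// density_ge0.
move=> uB uxB' utB.
apply: le_trans (ler_normD _ _) _; apply: lerD => //.
apply: le_trans (ler_normD _ _) _; rewrite !normrM; apply: lerD; first exact: ler_pM.
by apply: ler_pM => //; rewrite ?mulr_ge0//; exact: ler_pM.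
Qed.


Lemma compact_wedge (tau l : R) : compact [set z : R * R * R |
  [/\ 0 <= z.1.1 <= tau, 0 <= z.1.2, z.1.2 <= z.2 & z.2 <= l - B * z.1.1]].
Proof.
have c0 : continuous (fun z : R * R * R => z.1.1).
  by move=> z; apply: (@continuous_comp _ _ _ fst fst); exact: cvg_fst.
have c1 : continuous (fun z : R * R * R => z.1.2).
  move=> z; apply: (@continuous_comp _ _ _ fst snd); first exact: cvg_fst.
  exact: cvg_snd.
have c2 : continuous (fun z : R * R * R => z.2) by move=> z; exact: cvg_snd.
have cc : continuous (fun z : R * R * R => l - B * z.1.1).
  by move=> z; apply: cvgB; [exact: cvg_cst|apply: cvgM; [exact: cvg_cst|exact: c0]].
pose Q := `[0, tau]%classic `*` `[0, l + `|B| * tau]%classic `*`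
  `[0, l + `|B| * tau]%classic : set (R * R * R).
have cQ : compact Q by do 2?apply: compact_setX; exact: segment_compact.
rewrite (_ : [set z | _] = Q `&` [set z | z.1.2 <= z.2] `&`
  [set z | z.2 <= l - B * z.1.1]); last first.
  apply/seteqP; split => -[[t x] y] /=; last first.
    move=> [[[[]]]] /=; rewrite !in_itv/= => h1 /andP[h2 _] _ h3 h4.
    by split.
  move=> [tI x0 xy yl].
  have Bt : - B * t <= `|B| * tau.
    case/andP: tI => t0 tt; apply: (@le_trans _ _ (`|B| * t)).
      by rewrite ler_wpM2r// -normrN ler_norm.
    by rewrite ler_wpM2l.
  split => //; split => //; split; first split.
  - by rewrite /= in_itv.
  - by rewrite /= in_itv/= x0/=; lra.
  - by rewrite /= in_itv/= (le_trans x0)//=; lra.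
rewrite -setIA; apply: (subclosed_compact _ cQ); last by move=> z [].
apply: closedI; first by apply: compact_closed => //; exact: norm_hausdorff.
by apply: closedI; exact: closed_le_fun.
Qed.

(* The exponential growth rate of the density in space degrades at most linearly
   in time; comparing two points avoids second derivatives of the density. *)
Lemma density_increasing K lam tau l : tau < T -> B * tau <= 1 ->
  (forall t x y, 0 < t < T -> `|ux t y - ux t x| <= K * `|y - x|) ->
  0 < lam -> (K + lam * B) * tau <= lam ->
  (forall x y, 0 <= x -> x <= y -> y <= l ->
    expR (lam * (y - x)) * r 0 x <= r 0 y) ->
  forall t x y, 0 <= t <= tau -> 0 <= x -> x <= y -> y <= l - B * t ->
  r t x <= r t y.
Proof.
move=> tT Btau uxK lam0 Ctau r0 t x y tI x0 xy yl.
have tI' : 0 <= t < T by case/andP: tI => -> /= /le_lt_trans; exact.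
(* Along two characteristics the logarithm of the density ratio changes at a rate of at most
   [K (y - x)], and the stretching of [y - x] costs at most [lam B (y - x)]; the decay rate [C] of
   the exponent pays for both. *)
pose C := K + lam * B.
have B0 : 0 <= B by have [_ + _] := rb x tI'; exact: le_trans (normr_ge0 _).
have T0 : 0 < T by case/andP: tI' => /le_lt_trans; exact.
have K0 : 0 <= K.
  have := uxK (T / 2) 0 1; rewrite subr0 normr1 mulr1 divr_gt0//=.
  rewrite ltr_pdivrMr// ltr_pMr// ltr1n => /(_ isT).
  exact: le_trans (normr_ge0 _).
have C0 : 0 <= C by rewrite addr_ge0// mulr_ge0// ltW.
have kap s : 0 <= s <= tau -> 0 <= lam - C * s <= lam.
  by move=> /andP[s0 st]; apply/andP; rewrite /C in C0 *; split; nra.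
pose E s a b := expR ((lam - C * s) * (b - a)).
pose G := fun z : R * R * R => expR (- (B + 1) * z.1.1) *
  (r z.1.1 z.2 - E z.1.1 z.1.2 z.2 * r z.1.1 z.1.2).
have c0 : continuous (fun z : R * R * R => z.1.1).
  by move=> z; apply: (@continuous_comp _ _ _ fst fst); exact: cvg_fst.
have c1 : continuous (fun z : R * R * R => z.1.2).
  move=> z; apply: (@continuous_comp _ _ _ fst snd); first exact: cvg_fst.
  exact: cvg_snd.
have c2 : continuous (fun z : R * R * R => z.2) by move=> z; exact: cvg_snd.
have cG : continuous G.
  move=> z; apply: cvgM.
    apply: continuous_comp; last exact: continuous_expR.
    by apply: cvgM; [exact: cvg_cst|exact: c0].
  apply: cvgB.
    exact: (continuous_field (field_continuous r_field) c0 c2).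
  apply: cvgM.
    apply: continuous_comp; last exact: continuous_expR.
    apply: cvgM; last by apply: cvgB; [exact: c2|exact: c1].
    by apply: cvgB; [exact: cvg_cst|apply: cvgM; [exact: cvg_cst|exact: c0]].
  exact: (continuous_field (field_continuous r_field) c0 c1).
have := compact_nonneg (@compact_wedge tau l) cG _ (z := (t, x, y)).
rewrite /G/= pmulr_rge0 ?expR_gt0// subr_ge0 => H.
suff : E t x y * r t x <= r t y.
  apply: le_trans; rewrite ler_peMl ?density_ge0// -expR0 ler_expR.
  by case/andP: (kap t tI) => k0 _; rewrite mulr_ge0// subr_ge0.
apply: H; last by split.
clear t x y tI tI' x0 xy yl => -[[t x] y] /= [/andP[t0 tt] x0 xy yl]; rewrite pmulr_rlt0 ?expR_gt0// => neg.
have {}t0 : 0 < t.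
  rewrite lt_neqAle t0 andbT; apply/negP => /eqP t0'.
  have yl' : y <= l by move: yl; rewrite -t0' mulr0 subr0.
  have := r0 x y x0 xy yl'.
  by move: neg; rewrite -t0' /E mulr0 subr0 subr_lt0 => /lt_geF ->.
have tI : 0 < t < T by rewrite t0 (le_lt_trans tt).
have tI' : 0 <= t < T by rewrite ltW// (le_lt_trans tt).
have xlt : x < y.
  rewrite lt_neqAle xy andbT; apply/negP => /eqP xy'.
  by move: neg; rewrite xy' /E subrr mulr0 expR0 mul1r subrr ltxx.
(* On the face [x = 0] the subtracted density vanishes, so no negative value can occur there; this
   is where immobility of the vacuum boundary enters. *)
have {}x0 : 0 < x.
  rewrite lt_neqAle x0 andbT; apply/negP => /eqP x0'.
  have rx0 : r t x = 0.
    by apply: (vacuum_left tT Btau); [rewrite (ltW t0) tt|rewrite -x0'].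
  by move: neg; rewrite rx0 mulr0 subr0 ltNge density_ge0.
(* Each of the two points steps back with its own frozen velocity. *)
pose ta h : R := t + (-1) * h.
pose xa h : R := x + (- u t x) * h.
pose ya h : R := y + (- u t y) * h.
pose p := fun h : R => expR (- (B + 1) * ta h) *
  (r (ta h) (ya h) - expR ((lam - C * ta h) * (ya h - xa h)) * r (ta h) (xa h)).
have pd : is_derive (0 : R) 1 p (expR (- (B + 1) * t) *
    ((B + 1) * (r t y - E t x y * r t x) + (- (rt t y + u t y * rx t y)
     - (E t x y * (C * (y - x) + (lam - C * t) * (u t x - u t y)) * r t x
      - E t x y * (rt t x + u t x * rx t x))))).
  refine (is_derive_eq (is_derive_mulf (is_derive_expf (is_derive_scalef
    (- (B + 1)) (is_derive_affine t (-1) 0)))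
    (is_derive_subf (field_dir r_field y (-1) (- u t y) tI)
      (is_derive_mulf (is_derive_expf (is_derive_mulf
        (is_derive_subf (is_derive_cstf lam 0)
           (is_derive_scalef C (is_derive_affine t (-1) 0)))
        (is_derive_subf (is_derive_affine y (- u t y) 0)
           (is_derive_affine x (- u t x) 0))))
        (field_dir r_field x (-1) (- u t x) tI)))) _).
  by rewrite /E !mulr0 !addr0; ring.
have [|e e0 He] := is_derive_lt0 pd.
  rewrite pmulr_rlt0 ?expR_gt0//.
  have -> : rt t y + u t y * rx t y = - (r t y * ux t y).
    by have := continuity_eq y tI; lra.
  have -> : rt t x + u t x * rx t x = - (r t x * ux t x).
    by have := continuity_eq x tI; lra.
  have e0 : 0 <= E t x y * r t x by rewrite mulr_ge0 ?expR_ge0 ?density_ge0.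
  have yx0 : 0 < y - x by rewrite subr_gt0.
  have [_ _ ux1 _ _] := ub y tI.
  have := uxK t x y tI; have := u_lip x y tI.
  rewrite (gtr0_norm yx0) !ler_norml => /andP[_ u1] /andP[_ u2].
  have /andP[k0 k1] : 0 <= lam - C * t <= lam by apply: kap; rewrite ltW.
  pose H := r t y - E t x y * r t x; have negH : H < 0 := neg.
  rewrite -/H.
  (* The derivative splits into [H < 0] with a positive factor and a nonnegative factor times a
     defect that the choice of [C] makes nonpositive. *)
  have -> : (B + 1) * H + (- - (r t y * ux t y) -
    (E t x y * (C * (y - x) + (lam - C * t) * (u t x - u t y)) * r t x -
       E t x y * - (r t x * ux t x))) =
    (B + 1 + ux t y) * H + E t x y * r t x * (ux t y - ux t x - C * (y - x)
       + (lam - C * t) * (u t y - u t x)) by rewrite /H; ring.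
  have : (lam - C * t) * (u t y - u t x) <= lam * (B * (y - x)).
    apply: le_trans (ler_wpM2l k0 u1) _; apply: ler_wpM2r => //.
    by rewrite mulr_ge0// ltW.
  move=> u3.
  have : (B + 1 + ux t y) * H < 0 by rewrite pmulr_rlt0//; lra.
  have : E t x y * r t x * (ux t y - ux t x - C * (y - x)
       + (lam - C * t) * (u t y - u t x)) <= 0.
    have CE : C * (y - x) = K * (y - x) + lam * (B * (y - x)) by rewrite /C; ring.
    by rewrite mulr_ge0_le0//; lra.
  lra.
have [| |e1 e10 He1] := @edge_room _ x (u t x); [exact: ltW|by move=> xz; move: x0; rewrite xz ltxx|].
have [| |e2 e20 He2] := @edge_room _ (y - x) (u t y - u t x).
- by rewrite subr_ge0.
- by move=> h; move: xlt; rewrite -subr_gt0 h ltxx.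
pose h := Num.min t (Num.min e (Num.min e1 e2)) / 2.
have hm : 0 < Num.min t (Num.min e (Num.min e1 e2)) by rewrite !lt_min t0 e0 e10.
have h0 : 0 < h by rewrite divr_gt0.
have : h < Num.min t (Num.min e (Num.min e1 e2)).
  by rewrite ltr_pdivrMr// ltr_pMr// ltr1n.
rewrite !lt_min => /and4P[ht he he1 he2].
exists (ta h, xa h, ya h) => /=.
  have := He1 h; have := He2 h; rewrite h0 he1 he2 => /(_ isT) ? /(_ isT) ?.
  have [u1 _ _ _ _] := ub y tI.
  have : - B * h <= u t y * h by rewrite ler_wpM2r// ltW.
  by rewrite /ta /xa /ya; split; [apply/andP; split; lra|lra|lra|lra].
have := He h; rewrite h0 he => /(_ isT).
by rewrite /p /ta /xa /ya !mulr0 !addr0.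
Qed.

(* Hopf's lemma with the barrier [d (exp (M (x + s (t - tau))) - 1)], [s = l / tau]:
   it is nonpositive at [t = 0] and at [x = 0], and its slope at [(tau, 0)] is
   positive.  Degeneracy of the equation where [r = 0] is harmless since only an
   upper bound on [r] enters the choice of [M]. *)
Lemma hopf_boundary_bound tau l c : 0 < tau < T -> 0 < l -> 0 < c ->
  (forall t x, 0 < t <= tau -> 0 < x < l ->
    0 <= derive1 (fun y => r t y `^ gamma) x) ->
  (forall t, 0 < t <= tau -> u t 0 = 0) ->
  (forall t, 0 < t <= tau -> u t l <= - c) ->
  (forall x, 0 <= x <= l -> u 0 x <= 0) ->
  exists M d, [/\ 0 < M, 0 < d &
    forall x, 0 <= x <= l -> u tau x <= - (d * (expR (M * x) - 1))].
Proof.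
move=> /andP[tau0 tauT] l0 c0 px0 left right u0.
have T0 : 0 < T := lt_trans tau0 tauT.
have B0 : 0 <= B.
  have [|_ + _] := @rb 0 0; first by rewrite lexx.
  exact: le_trans (normr_ge0 _).
(* The zero of the barrier travels from [x = l] at time [0] to [x = 0] at time [tau]. *)
pose s := l / tau.
have s0 : 0 < s by rewrite divr_gt0.
(* Diffusion of the barrier, of size [nu M], must strictly exceed time change and transport, of size
   [B (s + B)]; the surplus is exactly [nu]. *)
pose M := B * (s + B) / nu + 1.
have M0 : 0 < M by rewrite ltr_wpDl// divr_ge0 ?mulr_ge0 ?addr_ge0// ltW.
have nuM : nu * M = B * (s + B) + nu.
  by rewrite /M mulrDr mulr1 mulrC divfK// gt_eqF.
(* At [x = l] this keeps [d b <= c], so the barrier stays below the strict bound on the velocity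
   there. *)
pose d := c / expR (M * l).
have d0 : 0 < d by rewrite divr_gt0// expR_gt0.
exists M, d; split => //.
pose b t x := expR (M * (x + s * (t - tau))).
pose G := fun z : R * R => - (u z.1 z.2 + d * (b z.1 z.2 - 1)).
have cG : continuous G.
  move=> z; apply: cvgN; apply: cvgD; first exact: (field_continuous u_field).
  apply: cvgM; first exact: cvg_cst.
  apply: cvgB; last exact: cvg_cst.
  apply: continuous_comp; last exact: continuous_expR.
  apply: cvgM; first exact: cvg_cst.
  apply: cvgD; first exact: cvg_snd.
  apply: cvgM; first exact: cvg_cst.
  by apply: cvgB; [exact: cvg_fst|exact: cvg_cst].
suff H : forall z : R * R, (0 <= z.1 <= tau /\ 0 + 0 * z.1 <= z.2 <= l - 0 * z.1) ->
    0 <= G z.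
  move=> x xI; have := H (tau, x); rewrite /G /b/= !mul0r subr0 addr0 xI.
  by rewrite ltW// lexx subrr mulr0 addr0 oppr_ge0 => /(_ (conj isT isT)); lra.
apply: (compact_nonneg (@compact_trapezoid _ tau 0 0 l 0) cG).
(* If no point has a lower value, [(t, x)] minimises [G], that is, maximises [u + d (b - 1)], with a
   positive value. *)
move=> -[t x] /= tx Gneg; apply: contrapT => nex.
have Gmin z : (0 <= z.1 <= tau /\ 0 <= z.2 <= l) -> G (t, x) <= G z.
  move=> zD; rewrite leNgt; apply/negP => Gz; apply: nex; exists z => //.
  by rewrite !mul0r addr0 subr0.
move: tx; rewrite !mul0r addr0 subr0 => -[/andP[t0 tt] /andP[x0 xl]].
have {Gneg} : 0 < u t x + d * (b t x - 1) by move: Gneg; rewrite /G /= oppr_lt0.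
move=> Gpos.
have b1 : b t x <= 1 -> 0 < u t x by move=> b1; nra.
have {}t0 : 0 < t.
  rewrite lt_neqAle t0 andbT; apply/negP => /eqP t0'.
  have : u t x <= 0 by rewrite -t0' u0// x0.
  rewrite leNgt => /negP; apply; apply: b1.
  rewrite -expR0 ler_expR pmulr_rle0// -t0' sub0r mulrN subr_le0.
  by rewrite /s divfK// gt_eqF.
have tt' : 0 < t <= tau by rewrite t0.
have tI : 0 < t < T by rewrite t0 (le_lt_trans tt).
have tI' : 0 <= t < T by rewrite ltW// (le_lt_trans tt).
have stau : s * (t - tau) <= 0 by rewrite pmulr_rle0// subr_le0.
have {}x0 : 0 < x.
  rewrite lt_neqAle x0 andbT; apply/negP => /eqP x0'.
  suff : 0 < u t x by rewrite -x0' left// ltxx.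
  by apply: b1; rewrite -expR0 ler_expR pmulr_rle0// -x0' add0r.
have {}xl : x < l.
  rewrite lt_neqAle xl andbT; apply/negP => /eqP xl'.
  have := right t tt'; rewrite -xl' => uc.
  have : d * b t x <= c.
    rewrite /d mulrAC ler_pdivrMr ?expR_gt0// ler_wpM2l// ?(ltW c0)// ler_expR.
    by rewrite ler_wpM2l ?(ltW M0)// xl'; lra.
  by nra.
have bt0 : 0 < b t x := expR_gt0 _.
pose E := d * (b t x * M).
have E0 : 0 < E by rewrite mulr_gt0// mulr_gt0.
(* Space conditions at an interior maximum; [E] is the slope of [d b] at [x]. *)
have [uxE uxxE] : ux t x + E = 0 /\ derive1 (ux t) x + E * M <= 0.
  have db (y : R) : is_derive y 1 (b t) (b t y * M).
    refine (is_derive_eq (is_derive_expf (is_derive_scalef M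
      (is_derive_addf (is_derive_id y 1) (is_derive_cstf (s * (t - tau)) y)))) _).
    by rewrite addr0 mulr1.
  pose f y := u t y + d * (b t y - 1).
  have := @is_derive_local_max _ f (fun y => ux t y + d * (b t y * M)) x
    (derive1 (ux t) x + E * M) (Num.min x (l - x)).
  apply.
  - move=> y; refine (is_derive_eq (is_derive_addf (field_dx u_field t y)
      (is_derive_scalef d (is_derive_subf (db y) (is_derive_cstf 1 y)))) _).
    by rewrite subr0.
  - refine (is_derive_eq (is_derive_addf (derivable_is_derive _)
      (is_derive_scalef d (is_derive_mulf (db x) (is_derive_cstf M x)))) _).
      by have [] := momentum x tI.
    by rewrite mulr0 addr0 mulrA.
  - by rewrite lt_min x0 subr_gt0.
  - move=> y; rewrite lt_min !ltr_norml => /andP[/andP[y1 _] /andP[_ y2]].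
    have := Gmin (t, y); rewrite /G /f /= lerN2; apply; split.
      by rewrite ltW.
    by apply/andP; split; lra.
(* The maximum may occur at [t = tau], so only backward comparison in time is possible, and it
   yields one sign. *)
have utE : 0 <= ut t x + s * E.
  rewrite leNgt; apply/negP => neg.
  pose p h := - (u (t + (-1) * h) (x + 0 * h) +
     d * (expR (M * (x + s * (t + (-1) * h - tau))) - 1)).
  have pd : is_derive (0 : R) 1 p (ut t x + s * E).
    refine (is_derive_eq (is_derive_oppf (is_derive_addf
      (field_dir u_field x (-1) 0 tI) (is_derive_scalef d (is_derive_subf
      (is_derive_expf (is_derive_scalef M (is_derive_addf (is_derive_cstf x 0)
       (is_derive_scalef s (is_derive_subf (is_derive_affine t (-1) 0)
       (is_derive_cstf tau 0))))))
      (is_derive_cstf 1 0))))) _).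
    by rewrite /E /b !mulr0 !addr0; ring.
  have [e e0 He] := is_derive_lt0 pd neg.
  pose h := Num.min t e / 2.
  have h0 : 0 < h by rewrite divr_gt0// lt_min t0.
  have : h < Num.min t e by rewrite ltr_pdivrMr ?ltr_pMr ?ltr1n// lt_min t0.
  rewrite lt_min => /andP[ht he].
  have := He h; rewrite h0 he => /(_ isT).
  rewrite ltNge => /negP; apply.
  rewrite /p !mulr0 !addr0 mul0r addr0.
  have := Gmin (t + (-1) * h, x); rewrite /G /b /=; apply; split.
    by apply/andP; split; lra.
  by rewrite !ltW.
have [_ _ eqm] := momentum x tI.
have := px0 t x tt'; rewrite x0 xl => /(_ isT) px.
have r0 := density_ge0 x tI'; have [rB _ _] := rb x tI'.
have [u1 u2 _ _ _] := ub x tI.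
have ux_ : ux t x = - E by lra.
have : nu * derive1 (ux t) x <= - (nu * M * E).
  have : nu * (derive1 (ux t) x + E * M) <= 0 by rewrite pmulr_rle0.
  lra.
have : - (B * (s + B) * E) <= r t x * ut t x + r t x * u t x * ux t x.
  have h1 : - ((s + B) * E) <= ut t x + u t x * ux t x.
    have : u t x * E <= B * E by rewrite ler_wpM2r// ltW.
    rewrite ux_; lra.
  have h2 : r t x * - ((s + B) * E) <= r t x * (ut t x + u t x * ux t x).
    exact: ler_wpM2l.
  have h3 : r t x * ((s + B) * E) <= B * ((s + B) * E).
    by rewrite ler_wpM2r// mulr_ge0 ?addr_ge0// ltW.
  lra.
(* The momentum equation bounds [nu uxx] below by [- B (s + B) E], the maximum bounds it above by
   [- nu M E]; these differ by [nu E] in the wrong direction. *)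
have : 0 < nu * E by rewrite mulr_gt0.
rewrite nuM; lra.
Qed.

Lemma pressure_dx_ge0 tau l : tau < T ->
  (forall t x y, 0 <= t <= tau -> 0 <= x -> x <= y -> y <= l -> r t x <= r t y) ->
  forall t x, 0 < t <= tau -> 0 < x < l ->
  0 <= derive1 (fun y => r t y `^ gamma) x.
Proof.
move=> tT mono t x /andP[t0 tt] /andP[x0 xl].
have tI : 0 < t < T by rewrite t0 (le_lt_trans tt).
have tI' : 0 <= t < T by rewrite ltW// (le_lt_trans tt).
have [/derivable_is_derive dp _ _] := momentum x tI.
rewrite leNgt; apply/negP => neg.
have [|e e0 He] := is_derive_gt0 (is_derive_oppf dp); first by rewrite oppr_gt0.
pose h := Num.min e (l - x) / 2.
have m0 : 0 < Num.min e (l - x) by rewrite lt_min e0 subr_gt0.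
have h0 : 0 < h by rewrite divr_gt0.
have : h < Num.min e (l - x) by rewrite ltr_pdivrMr// ltr_pMr// ltr1n.
rewrite lt_min => /andP[he hl].
have [|_] := He h; first by rewrite h0.
rewrite ltrN2 ltNge ge0_ler_powR ?nnegrE ?density_ge0//.
  by rewrite ltW// (lt_trans _ gamma1).
by apply: mono; rewrite ?(ltW t0) ?(ltW x0)//; lra.
Qed.

Lemma no_flow lam L : 0 < T -> 0 < L -> 0 < lam ->
  (forall x y, 0 <= x -> x <= y -> y <= L ->
    expR (lam * (y - x)) * r 0 x <= r 0 y) ->
  u 0 L < 0 -> (forall x, 0 <= x <= L -> u 0 x <= 0) -> False.
Proof.
move=> T0 L0 lam0 r0 uL u0.
have [K uxK] := velocity_dx_lipschitz.
have B0 : 0 <= B.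
  have [|_ + _] := @rb 0 0; first by rewrite lexx.
  exact: le_trans (normr_ge0 _).
have uL2 : u 0 L < u 0 L / 2 by lra.
have cu : {for (0, L), continuous (fun z : R * R => u z.1 z.2)}.
  exact: (field_continuous u_field).
have [[P Q] [/= [d1 /= d10 H1] [d2 /= d20 H2]] PQ] := cvgr_lt _ cu _ uL2.
have [d d0 [dd1 dd2]] : exists2 d, 0 < d & d <= d1 /\ d <= d2.
  exists (Num.min d1 d2); first by rewrite lt_min d10.
  by rewrite !ge_min !lexx orbT.
have m0 : 0 < Num.min d L by rewrite lt_min d0.
(* A margin to the left of [L]: small enough that [u] stays negative at [l = L - g], and available
   to absorb the narrowing [B t] of the region of monotonicity. *)
pose g := Num.min d L / 2.
have g0 : 0 < g by rewrite divr_gt0.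
have : g < Num.min d L by rewrite ltr_pdivrMr// ltr_pMr// ltr1n.
rewrite lt_min => /andP[gd gL].
pose l := L - g.
have l0 : 0 < l by rewrite subr_gt0.
pose C := `|K + lam * B|.
have C0 : 0 <= C by exact: normr_ge0.
(* In order: the lifespan, persistence of the negative velocity, [B tau <= 1] for the vacuum, a
   nonnegative remaining growth exponent, and [B tau <= g] for the margin. Halving makes all bounds
   strict. *)
pose tau := Num.min (Num.min T d)
  (Num.min (B + 1)^-1 (Num.min (lam / (C + 1)) (g / (B + 1)))) / 2.
have B1 : 0 < B + 1 by rewrite ltr_wpDl.
have C1 : 0 < C + 1 by rewrite ltr_wpDl.
have m1 : 0 < Num.min (Num.min T d)
  (Num.min (B + 1)^-1 (Num.min (lam / (C + 1)) (g / (B + 1)))).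
  by rewrite !lt_min T0 d0 invr_gt0 B1 (divr_gt0 lam0 C1) (divr_gt0 g0 B1).
have tau0 : 0 < tau by rewrite divr_gt0.
have : tau < Num.min (Num.min T d)
  (Num.min (B + 1)^-1 (Num.min (lam / (C + 1)) (g / (B + 1)))).
  by rewrite ltr_pdivrMr// ltr_pMr// ltr1n.
rewrite !lt_min => /and3P[/andP[tT td] tB /andP[tC tg]].
have Btau : B * tau <= 1.
  have : tau * (B + 1) < 1 by rewrite -ltr_pdivlMr// div1r.
  nra.
have Ctau : (K + lam * B) * tau <= lam.
  have : tau * (C + 1) < lam by rewrite -ltr_pdivlMr.
  have := ler_norm (K + lam * B); rewrite -/C; nra.
have Bg : B * tau <= g.
  have : tau * (B + 1) < g by rewrite -ltr_pdivlMr.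
  nra.
have mono t x y : 0 <= t <= tau -> 0 <= x -> x <= y -> y <= l -> r t x <= r t y.
  move=> tI x0 xy yl.
  apply: (density_increasing tT Btau uxK lam0 Ctau r0) => //.
  case/andP: tI => t0 tt; apply: (le_trans yl); rewrite /l.
  have : B * t <= B * tau by rewrite ler_wpM2l.
  lra.
have px := pressure_dx_ge0 tT mono.
have left t : 0 < t <= tau -> u t 0 = 0.
  by move=> tI; exact: (velocity_left tT Btau).
have right t : 0 < t <= tau -> u t l <= - (- (u 0 L / 2)).
  move=> /andP[t0 tt]; rewrite opprK; apply: ltW; apply: (PQ (t, l)).
  have td1 := lt_le_trans td dd1; have gd2 := lt_le_trans gd dd2.
  split; [apply: H1|apply: H2]; rewrite /ball/=.
    by rewrite sub0r normrN gtr0_norm// (le_lt_trans tt).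
  by rewrite /l subKr gtr0_norm.
have [|||M [b [M0 b0 Hb]]] := @hopf_boundary_bound tau l (- (u 0 L / 2)) _ l0 _ px left right.
- by rewrite tau0.
- lra.
- by move=> x /andP[x0 xl]; apply: u0; rewrite x0/=; move: xl; rewrite /l; lra.
have tauI : 0 < tau <= tau by rewrite tau0 lexx.
have uz x : x <= 0 -> u tau x = 0 by exact: (velocity_left tT Btau).
(* The derivative at [0] is two-sided and [u] vanishes on the left, so a nonzero slope is already
   refuted by points [- h < 0]. *)
have ux0 : ux tau 0 = 0.
  have du := field_dx u_field tau 0.
  apply/eqP; case: ltgtP => // h.
    have [|e e0 He] := is_derive_gt0 (is_derive_oppf du); first by rewrite oppr_gt0.
    have [|+ _] := He (e / 2); first by rewrite divr_gt0//= ltr_pdivrMr// ltr_pMr// ltr1n.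
    by rewrite ltrN2 !uz ?ltxx// sub0r oppr_le0 divr_ge0// ltW.
  have [e e0 He] := is_derive_gt0 du h.
  have [|+ _] := He (e / 2); first by rewrite divr_gt0//= ltr_pdivrMr// ltr_pMr// ltr1n.
  by rewrite !uz ?ltxx// sub0r oppr_le0 divr_ge0// ltW.
have dg : is_derive (0 : R) 1 (fun x => u tau x + b * (expR (0 + M * x) - 1)) (b * M).
  refine (is_derive_eq (is_derive_addf (field_dx u_field tau 0)
    (is_derive_scalef b (is_derive_subf (is_derive_expf (is_derive_affine 0 M 0))
    (is_derive_cstf 1 0)))) _).
  by rewrite ux0 mulr0 addr0 expR0 mul1r subr0 add0r.
have [|e e0 He] := is_derive_gt0 dg; first by rewrite mulr_gt0.
pose h := Num.min e l / 2.
have m2 : 0 < Num.min e l by rewrite lt_min e0.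
have h0 : 0 < h by rewrite divr_gt0.
have : h < Num.min e l by rewrite ltr_pdivrMr// ltr_pMr// ltr1n.
rewrite lt_min => /andP[he hl].
have [|_] := He h; first by rewrite h0.
rewrite mulr0 !add0r expR0 subrr mulr0 addr0 (left _ tauI) => H.
by have := Hb h; rewrite (ltW h0) (ltW hl) => /(_ isT); lra.
Qed.

End Flow.

(** * Reflection and initial growth *)

Section Reflection.
Context {R : realType}.

(* The momentum equation is conditional because [powR] takes the value 1 on
   negative bases: the sign of the density has to be established first. *)
Record flow (r rx rt u ux ut : R -> R -> R) (B T nu gamma : R) : Prop := Flow {
  flow_density : C1_field r rx rt B T;
  flow_velocity : C1_field u ux ut B T;
  flow_continuity : forall t x, 0 < t < T ->
    rt t x + u t x * rx t x + r t x * ux t x = 0;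
  flow_momentum : (forall t x, 0 <= t < T -> 0 <= r t x) ->
    forall t x, 0 < t < T ->
    [/\ derivable (fun y => r t y `^ gamma) x 1, derivable (ux t) x 1 &
      r t x * ut t x + r t x * u t x * ux t x + derive1 (fun y => r t y `^ gamma) x
      = nu * derive1 (ux t) x];
  flow_decay : forall t a c, 0 < t < T ->
    (forall x, x < a -> u t x = c) \/ (forall x, a < x -> u t x = c) -> c = 0;
  flow_ge0 : forall x, 0 <= r 0 x;
  flow_vacuum : forall x, x <= 0 \/ 1 <= x -> r 0 x = 0 }.

Lemma is_derive_reflect (f : R -> R) (x a : R) : is_derive (1 - x) 1 f a ->
  is_derive x 1 (fun y => f (1 - y)) (- a).
Proof.
move=> fa; refine (is_derive_eq (@is_derive_compf _ f (fun y => 1 - y) x a _ fa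
  (is_derive_subf (is_derive_cstf 1 x) (is_derive_id x 1))) _).
by rewrite sub0r mulrN1.
Qed.

Lemma C1_field_reflect (F Fx Ft : R -> R -> R) (B T : R) : C1_field F Fx Ft B T ->
  C1_field (fun t x => F t (1 - x)) (fun t x => - Fx t (1 - x))
    (fun t x => Ft t (1 - x)) B T.
Proof.
case=> cF dF dirF bF; split.
- apply: (continuous_field cF); first by move=> z; exact: cvg_fst.
  by move=> z; apply: cvgB; [exact: cvg_cst|exact: cvg_snd].
- by move=> t x; exact: is_derive_reflect.
- move=> t x a b tI.
  have := dirF t (1 - x) a (- b) tI.
  rewrite (_ : (fun h => F (t + a * h) (1 - x + - b * h)) =
    fun h => F (t + a * h) (1 - (x + b * h))); last first.
    by apply/funext => h; congr (F _ _); ring.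
  by rewrite mulNr mulrN.
- by move=> t x tI; rewrite normrN; exact: bF.
Qed.

(** Under [x -> 1 - x] the velocity changes sign while [ux] does not; the momentum equation is
    multiplied by [-1]. The disjunction in [flow_decay] covers both half-lines, which the reflection
    exchanges. *)
Lemma flow_reflect r rx rt u ux ut (B T nu gamma : R) :
  flow r rx rt u ux ut B T nu gamma ->
  flow (fun t x => r t (1 - x)) (fun t x => - rx t (1 - x)) (fun t x => rt t (1 - x))
    (fun t x => - u t (1 - x)) (fun t x => - - ux t (1 - x))
    (fun t x => - ut t (1 - x)) B T nu gamma.
Proof.
case=> Fr Fu cont mom decay ge0 vac; split.
- exact: C1_field_reflect.
- exact: C1_fieldN (C1_field_reflect Fu).
- by move=> t x tI; rewrite -(cont t (1 - x) tI); ring.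
- move=> rge0 t x tI.
  have rge0' s y : 0 <= s < T -> 0 <= r s y.
    by move=> sI; have := rge0 s (1 - y) sI; rewrite subKr.
  have [dp du E] := mom rge0' t (1 - x) tI.
  have dp' := is_derive_reflect (derivable_is_derive dp).
  have du' := is_derive_oppf (is_derive_oppf (is_derive_reflect (derivable_is_derive du))).
  split; [by case: dp'|by case: du'|].
  rewrite (is_derive_derive1 dp') (is_derive_derive1 du').
  transitivity (- (nu * derive1 (ux t) (1 - x))); last by ring.
  by rewrite -E; ring.
- move=> t a c tI H; apply/eqP; rewrite -oppr_eq0; apply/eqP.
  apply: (decay t (1 - a) _ tI); case: H => H; [right|left] => x xa.
    by rewrite -(H (1 - x)) ?subKr ?opprK//; lra.
  by rewrite -(H (1 - x)) ?subKr ?opprK//; lra.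
- by move=> x.
- by move=> x x01; apply: vac; case: x01 => ?; [right|left]; lra.
Qed.

(** With the integrating factor, [exp (- lam z) f z] is nondecreasing in the open interval. The
    endpoint [0] is trivial because [f 0 = 0], and [L] is reached by continuity. *)
Lemma log_derivative_growth (f : R -> R) (lam L : R) : continuous f ->
  (forall x, 0 <= f x) -> f 0 = 0 -> (forall x, 0 < x < L -> 0 < f x) ->
  (forall x, 0 < x < L -> derivable f x 1 /\ lam <= derive1 f x / f x) ->
  forall x y, 0 <= x -> x <= y -> y <= L -> expR (lam * (y - x)) * f x <= f y.
Proof.
move=> cf f0 f00 fpos fd x y; rewrite le_eqVlt => /orP[/eqP <- _ _|x0].
  by rewrite f00 mulr0.
rewrite le_eqVlt => /orP[/eqP -> _|xy yL]; first by rewrite subrr mulr0 expR0 mul1r.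
pose g z := expR (0 + (- lam) * z) * f z.
have dg (z : R) : z \in `]x, y[ -> is_derive z 1 g
    (expR (- lam * z) * (derive1 f z - lam * f z)).
  rewrite in_itv/= => /andP[xz zy].
  have [|df _] := fd z; first by rewrite (lt_trans x0)//= (lt_le_trans zy).
  refine (is_derive_eq (is_derive_mulf (is_derive_expf (is_derive_affine 0 (- lam) z))
    (derivable_is_derive df)) _).
  by rewrite add0r; ring.
have cg : {within `[x, y], continuous g}.
  apply: continuous_subspaceT => z; apply: cvgM; last exact: cf.
  exact: is_derive_continuous (is_derive_expf (is_derive_affine 0 (- lam) z)).
have [c cxy gc] := MVT xy dg cg.
move: cxy; rewrite in_itv/= => /andP[xc cy].
have cI : 0 < c < L by rewrite (lt_trans x0)//= (lt_le_trans cy).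
have [_] := fd c cI; rewrite ler_pdivlMr ?fpos// => fc.
have : 0 <= g y - g x.
  by rewrite gc mulr_ge0 ?subr_ge0 ?(ltW xy)// mulr_ge0 ?expR_ge0// subr_ge0.
rewrite subr_ge0 /g !add0r => H.
have -> : lam * (y - x) = lam * y + - lam * x by ring.
rewrite expRD -mulrA.
apply: le_trans (ler_wpM2l (expR_ge0 _) H) _.
by rewrite mulrA -expRD mulNr subrr expR0 mul1r.
Qed.

End Reflection.

(** * A smooth step *)

Section SmoothStep.
Context {R : realType}.
Implicit Types f g df : R -> R.

(** Differentiability of order [n] with explicit witnesses for the derivatives, so that closure
    under sums, products and inverses is a plain induction; [Cn_derivable] translates back to
    [derive1n]. *)
Fixpoint Cn n f : Prop := if n is n'.+1 then
  exists2 df, (forall x : R, is_derive x 1 f (df x)) & Cn n' df else True.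

Lemma Cn_derivable n f : Cn n.+1 f -> forall x, derivable (derive1n n f) x 1.
Proof.
elim: n f => [|n IH] f [df fdf dfn] x.
  by rewrite derive1n0; case: (fdf x).
rewrite derive1Sn; have -> : derive1 f = df; last exact: IH.
by apply/funext => y; rewrite derive1E; case: (fdf y).
Qed.

Lemma CnW n f : Cn n.+1 f -> Cn n f.
Proof. by elim: n f => [//|n IH] f [df fdf /IH dfn]; exists df. Qed.

Lemma CnD n f g : Cn n f -> Cn n g -> Cn n (fun x => f x + g x).
Proof.
elim: n f g => [//|n IH] f g [df fdf dfn] [dg gdg dgn].
by exists (fun x => df x + dg x); [move=> x; exact: is_derive_addf|exact: IH].
Qed.

Lemma CnZ n f (c : R) : Cn n f -> Cn n (fun x => c * f x).
Proof.
elim: n f => [//|n IH] f [df fdf dfn].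
by exists (fun x => c * df x); [move=> x; exact: is_derive_scalef|exact: IH].
Qed.

Lemma CnM n f g : Cn n f -> Cn n g -> Cn n (fun x => f x * g x).
Proof.
elim: n f g => [//|n IH] f g fn gn; move: (CnW fn) (CnW gn) => fn' gn'.
case: fn gn => [df fdf dfn] [dg gdg dgn].
exists (fun x => df x * g x + f x * dg x); first by move=> x; exact: is_derive_mulf.
by apply: CnD; exact: IH.
Qed.

Lemma Cn_affine n f (a b : R) : Cn n f -> Cn n (fun x => f (a + b * x)).
Proof.
elim: n f => [//|n IH] f [df fdf dfn].
exists (fun x => b * df (a + b * x)); last by apply: CnZ; exact: IH.
move=> x; rewrite mulrC; exact: (is_derive_compf (fdf _) (is_derive_affine a b x)).
Qed.

Lemma CnV n f : (forall x, f x != 0) -> Cn n f -> Cn n (fun x => (f x)^-1).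
Proof.
move=> f0; elim: n => [//|n IH] fn; move: (CnW fn) => fn'.
case: fn => [df fdf dfn].
exists (fun x => -1 * (df x * ((f x)^-1 * (f x)^-1))).
  move=> x; apply: (is_derive_eq (is_deriveV (f0 x) (fdf x))).
  by rewrite /GRing.scale/= expr2 mulN1r mulNr mulrC invfM.
by apply: CnZ; apply: CnM => //; apply: CnM; exact: IH.
Qed.

(** The functions [x^(-k) exp (- 1 / x)], extended by zero. The span of this family is closed under
    differentiation, so smoothness of [exp (- 1 / x)] follows by induction with [k] generalised. *)
Definition flat k (x : R) : R := if 0 < x then x^-1 ^+ k * expR (- x^-1) else 0.

(** For [n = k + 1] and [v = 1 / x], [exp v = (exp (v / n))^n >= (v / n)^n], which leaves one spare
    power of [x]. *)
Lemma flat_bound k : exists2 c, 0 < c & forall x : R, 0 <= flat k x <= c * `|x|.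
Proof.
exists (k.+1%:R ^+ k.+1); first by rewrite exprn_gt0.
move=> x; rewrite /flat; case: ltP => x0; last by rewrite lexx mulr_ge0// exprn_ge0.
have v0 : 0 < x^-1 by rewrite invr_gt0.
rewrite mulr_ge0 ?exprn_ge0 ?expR_ge0 ?(ltW v0)//= gtr0_norm//.
rewrite expRN ler_pdivrMr ?expR_gt0//.
have n0 : k.+1%:R != 0 :> R by rewrite pnatr_eq0.
have H : (x^-1 / k.+1%:R) ^+ k.+1 <= expR (x^-1).
  rewrite -{2}[x^-1](divfK n0) [_ * k.+1%:R]mulrC expRM_natl.
  rewrite lerXn2r ?nnegrE ?expR_ge0//; first by rewrite divr_ge0// ltW.
  by apply: le_trans (expR_ge1Dx _); rewrite lerDr.
have -> : x^-1 ^+ k = x * x^-1 ^+ k.+1 by rewrite exprS mulrA divff ?mul1r// gt_eqF.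
rewrite [_ * x]mulrC -mulrA ler_wpM2l ?(ltW x0)//.
by rewrite -{1}[x^-1](divfK n0) exprMn mulrC ler_wpM2l// exprn_ge0.
Qed.

Lemma flat_derive k (x : R) :
  is_derive x 1 (flat k) (- k%:R * flat k.+1 x + flat k.+2 x).
Proof.
have [x0|x0|->] := ltgtP x 0.
- rewrite /flat ltNge (ltW x0)/= mulr0 addr0.
  have H : is_derive x 1 (fun=> 0) (0 : R) by exact: is_derive_cstf.
  apply: near_eq_is_derive; near=> y.
  by rewrite ltNge ltW//; near: y; exact: lt_nbhsl.
- have xn0 : x != 0 by rewrite gt_eqF.
  have dv : is_derive x 1 (fun y : R => y^-1) (- (x^-1 * x^-1)).
    apply: (is_derive_eq (is_deriveV xn0 (is_derive_id x 1))).
    by rewrite /GRing.scale/= mulr1 expr2 invfM.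
  have dk : is_derive x 1 (fun y : R => y^-1 ^+ k) (- k%:R * x^-1 ^+ k.+1).
    have dp : is_derive (x^-1) 1 (fun z : R => z ^+ k) (k%:R * x^-1 ^+ k.-1).
      split; first exact: exprn_derivable.
      by rewrite exp_derive /GRing.scale/= mulr1.
    apply: (is_derive_eq (is_derive_compf dp dv)).
    case: k {dp} => [|k]; first by rewrite !mul0r oppr0 mul0r.
    by rewrite !exprS/=; ring.
  have := is_derive_mulf dk (is_derive_expf (is_derive_oppf dv)).
  rewrite {2 3}/flat x0 => H.
  apply: (@is_derive_eq _ _ _ _ _ _ _ (- k%:R * x^-1 ^+ k.+1 * expR (- x^-1)
     + x^-1 ^+ k * (expR (- x^-1) * - - (x^-1 * x^-1)))); last first.
    by rewrite !exprS; ring.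
  apply: near_eq_is_derive; near=> y; rewrite /flat ifT//.
  by near: y; exact: lt_nbhsr.
- rewrite /flat ltxx mulr0 addr0; apply: quotient_is_derive.
  have [c c0 Hc] := flat_bound k.+1.
  apply/cvgr0Pnorm_lt => e e0; near=> h.
  rewrite add0r ltxx subr0.
  (* The difference quotient at [0] is the next member of the family, which tends to zero by the
     linear bound. *)
  have -> : h^-1 * (if 0 < h then h^-1 ^+ k * expR (- h^-1) else 0) = flat k.+1 h.
    by rewrite /flat; case: ifP => _; rewrite ?mulr0// exprS mulrA.
  have /andP[f0 fc] := Hc h; rewrite ger0_norm// (le_lt_trans fc)//.
  rewrite mulrC -ltr_pdivlMr//; near: h.
  by apply: dnbhs0_lt; rewrite divr_gt0.
Unshelve. all: by end_near. Qed.

Lemma Cn_flat n k : Cn n (flat k).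
Proof.
elim: n k => [//|n IH] k.
exists (fun x => - k%:R * flat k.+1 x + flat k.+2 x); first exact: flat_derive.
by apply: CnD; [apply: CnZ|]; exact: IH.
Qed.

Definition smooth_step (x : R) : R := flat 0 x / (flat 0 x + flat 0 (1 - x)).

Lemma flat0_gt0 (x : R) : 0 < x -> 0 < flat 0 x.
Proof. by move=> x0; rewrite /flat x0 expr0 mul1r expR_gt0. Qed.

Lemma flat0_ge0 (x : R) : 0 <= flat 0 x.
Proof. by have [c _ /(_ x)/andP[]] := flat_bound 0. Qed.

Lemma smooth_step_den (x : R) : 0 < flat 0 x + flat 0 (1 - x).
Proof.
have [x0|x0] := ltP 0 x; first by rewrite ltr_pwDl ?flat0_gt0 ?flat0_ge0.
rewrite ltr_wpDl ?flat0_ge0 ?flat0_gt0//; lra.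
Qed.

Lemma Cn_smooth_step n : Cn n smooth_step.
Proof.
apply: CnM; first exact: Cn_flat.
apply: CnV; first by move=> x; rewrite gt_eqF// smooth_step_den.
apply: CnD; first exact: Cn_flat.
have -> : (fun x : R => flat 0 (1 - x)) = (fun x => flat 0 (1 + (-1) * x)).
  by apply/funext => x; rewrite mulN1r.
by apply: Cn_affine; exact: Cn_flat.
Qed.

Lemma smooth_step_le0 (x : R) : x <= 0 -> smooth_step x = 0.
Proof. by move=> x0; rewrite /smooth_step {1}/flat ltNge x0 mul0r. Qed.

Lemma smooth_step_ge1 (x : R) : 1 <= x -> smooth_step x = 1.
Proof.
move=> x0; rewrite /smooth_step {3}/flat ltNge subr_le0 x0/= addr0 divff//.
by rewrite gt_eqF// flat0_gt0// (lt_le_trans ltr01).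
Qed.

Lemma smooth_step01 (x : R) : 0 <= smooth_step x <= 1.
Proof.
rewrite /smooth_step divr_ge0 ?flat0_ge0 ?(ltW (smooth_step_den x))//=.
by rewrite ler_pdivrMr ?smooth_step_den// mul1r lerDl flat0_ge0.
Qed.

Lemma smooth_step_derive : exists dS C, [/\
  forall x : R, is_derive x 1 smooth_step (dS x), continuous dS,
  forall x, x < 0 \/ 1 < x -> dS x = 0, 0 < C & forall x, `|dS x| <= C].
Proof.
have [dS SdS [ddS dSd _]] := Cn_smooth_step 2.
have cdS : continuous dS by move=> x; exact: is_derive_continuous (dSd x).
have out x : x < 0 \/ 1 < x -> dS x = 0.
  move=> xout; have := is_derive_derive1 (SdS x) => <-.
  apply: is_derive_derive1.
  case: xout => xout.
    have : is_derive x 1 (fun=> 0) (0 : R) by exact: is_derive_cstf.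
    apply: near_eq_is_derive; near=> y; rewrite smooth_step_le0// ltW//.
    by near: y; exact: lt_nbhsl.
  have : is_derive x 1 (fun=> 1 : R) (0 : R) by exact: is_derive_cstf.
  apply: near_eq_is_derive; near=> y; rewrite smooth_step_ge1// ltW//.
  by near: y; exact: lt_nbhsr.
have [c cI cmax] : exists2 c, c \in `[(0 : R), 1] &
    forall t, t \in `[(0 : R), 1] -> `|dS t| <= `|dS c|.
  apply: (@EVT_max _ (fun x => `|dS x|)) => //; apply: continuous_subspaceT => x.
  exact: (continuous_comp (cdS x) (@norm_continuous _ _ _)).
exists dS, (`|dS c| + 1); split; [exact: SdS|exact: cdS|exact: out|by rewrite ltr_wpDl|].
move=> x; have [xI|] := boolP (x \in `[(0 : R), 1]).
  by rewrite (le_trans (cmax _ xI))// lerDl.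
rewrite in_itv/= negb_and -!ltNge => /orP xI.
by rewrite out// normr0 addr_ge0.
Unshelve. all: by end_near. Qed.

End SmoothStep.

(** * Local estimates for square integrable functions *)

Section LocalL2.
Context {R : realType}.
Local Notation mu := (@lebesgue_measure R).
Implicit Types f g p : R -> R.

Lemma L2_sq_integrable f : L2 f -> mu.-integrable setT (fun x => ((f x) ^+ 2)%:E).
Proof.
move=> [mf foo]; apply/integrableP; split.
  by apply/measurable_EFinP; exact: measurable_funX.
by under eq_integral do rewrite gee0_abs ?lee_fin ?sqr_ge0//.
Qed.

Lemma lebesgue_itv (a b : R) : a <= b -> mu `[a, b] = (b - a)%:E.
Proof.
rewrite lebesgue_measure_itv/= lte_fin le_eqVlt => /orP[/eqP ->|->//].
by rewrite ltxx subrr.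
Qed.

Lemma cst_integrable_itv (a b c : R) : mu.-integrable `[a, b] (EFin \o cst c).
Proof.
have ab : (mu `[a, b] < +oo)%E.
  by rewrite lebesgue_measure_itv/=; case: ifP => _; rewrite ?ltry.
apply: measurable_bounded_integrable => //.
by exists `|c|; split; [exact: num_real|move=> M /ltW cM x _].
Qed.

(** On a bounded interval [|f| <= 1 + f^2] is integrable. *)
Lemma L2_integrable_itv f (a b : R) : L2 f -> mu.-integrable `[a, b] (EFin \o f).
Proof.
move=> f2; have [mf _] := f2.
have i2 : mu.-integrable `[a, b] (fun x => ((f x) ^+ 2)%:E).
  by apply: integrableS (L2_sq_integrable f2).
have i1 := cst_integrable_itv a b 1.
apply: le_integrable (integrableD _ i1 i2) => //.
  by apply/measurable_EFinP; exact: measurable_funS mf.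
move=> x _ /=; rewrite lee_fin.
rewrite (ger0_norm (x := 1 + f x ^+ 2)) ?addr_ge0 ?sqr_ge0//.
rewrite ler_norml; apply/andP; split; nra.
Qed.

(* AM-GM: [2 |f| <= eta + f^2 / eta]. *)
Lemma L2_itv_bound f (N a b eta : R) : L2 f ->
  (\int[mu]_x (((f x) ^+ 2)%:E) <= N%:E)%E -> a <= b -> 0 < eta ->
  \int[mu]_(x in `[a, b]) `|f x| <= (eta * (b - a) + N / eta) / 2.
Proof.
move=> f2 fN ab eta0.
have i2 : mu.-integrable `[a, b] (EFin \o (fun x => (f x) ^+ 2)).
  by apply: integrableS (L2_sq_integrable f2).
have i1 := cst_integrable_itv a b (eta / 2).
have i3 : mu.-integrable `[a, b] (EFin \o (fun x => (2 * eta)^-1 * (f x) ^+ 2)).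
  by have := integrableZl _ (2 * eta)^-1 i2; apply; exact: measurable_itv.
have -> : (eta * (b - a) + N / eta) / 2 = eta / 2 * (b - a) + (2 * eta)^-1 * N.
  by field; rewrite gt_eqF.
apply: (@le_trans _ _ (\int[mu]_(x in `[a, b])
    (cst (eta / 2) x + (2 * eta)^-1 * (f x) ^+ 2))).
  apply: le_Rintegral => //.
  - by apply: integrable_norm; exact: L2_integrable_itv.
  - exact: (integrableD _ i1 i3).
  - move=> x _ /=.
    have -> : eta / 2 + (2 * eta)^-1 * f x ^+ 2 =
      `|f x| + (eta - `|f x|) ^+ 2 / (2 * eta).
      rewrite -(real_normK (num_real (f x))); field; rewrite gt_eqF//.
    by rewrite lerDl divr_ge0 ?sqr_ge0// mulr_ge0// ltW.
rewrite RintegralD// [X in _ + X]RintegralZl//.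
apply: lerD.
  have -> : \int[mu]_(x in `[a, b]) cst (eta / 2) x = eta / 2 * fine (mu `[a, b]).
    by rewrite -Rintegral_cst.
  by rewrite lebesgue_itv.
rewrite ler_wpM2l ?invr_ge0 ?mulr_ge0 ?(ltW eta0)//.
rewrite -lee_fin fineK; last exact: (integrable_fin_num _ i2).
apply: le_trans fN; apply: ge0_subset_integral => //.
- apply/measurable_EFinP; apply: measurable_funX; by case: f2.
- by move=> x _; rewrite lee_fin sqr_ge0.
Qed.

Lemma L2_itv_bound_norm f (N a b eta : R) : L2 f ->
  (\int[mu]_x (((f x) ^+ 2)%:E) <= N%:E)%E -> a <= b -> 0 < eta ->
  `|\int[mu]_(x in `[a, b]) f x| <= (eta * (b - a) + N / eta) / 2.
Proof.
move=> f2 fN ab eta0; apply: le_trans (L2_itv_bound f2 fN ab eta0).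
by apply: le_normr_Rintegral => //; exact: L2_integrable_itv.
Qed.

Lemma Rintegral_mul_indic f (a b : R) :
  \int[mu]_(x in `[a, b]) f x = \int[mu]_x (f x * \1_`[a, b] x).
Proof.
rewrite Rintegral_mkcond; apply: eq_Rintegral => x _.
by rewrite patchE indicE; case: ifP => _; rewrite ?mulr1 ?mulr0.
Qed.

Lemma mul_integrable_itv f p (a b C : R) : measurable_fun setT f ->
  mu.-integrable `[a, b] (EFin \o f) -> measurable_fun setT p ->
  (forall x, `|p x| <= C) -> (forall x, x \notin `[a, b] -> p x = 0) ->
  mu.-integrable setT (EFin \o (fun x => f x * p x)).
Proof.
move=> mf H mp pC p0.
have [+ _] := @integrable_mkcond _ _ R mu `[a, b]%classic (EFin \o f) (measurable_itv _).
move=> /(_ H).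
move=> /(integrableZl measurableT C) H'.
apply: le_integrable H' => //.
  apply/measurable_EFinP; exact: measurable_funM.
move=> x _ /=; rewrite patchE; case: ifPn => [_|]; last first.
  by rewrite mem_setE => xab; rewrite p0// mulr0 normr0 mule0 abse0.
rewrite lee_fin !normrM mulrC ler_wpM2r//.
by rewrite (le_trans (pC x))// ler_norm.
Qed.

Lemma L2_mul_integrable f p (a b C : R) : L2 f -> measurable_fun setT p ->
  (forall x, `|p x| <= C) -> (forall x, x \notin `[a, b] -> p x = 0) ->
  mu.-integrable setT (EFin \o (fun x => f x * p x)).
Proof.
move=> f2; apply: mul_integrable_itv; last exact: L2_integrable_itv.
by case: f2.
Qed.

Lemma L2_locally_integrable f : L2 f -> locally_integrable setT f.
Proof.
move=> f2; have [mf _] := f2; split => //; first exact: openT.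
move=> K _ cK.
have [M [_ /(_ (`|M| + 1))]] := compact_bounded cK.
rewrite (le_lt_trans (ler_norm M)) ?ltrDl// => /(_ isT) KM.
have := L2_integrable_itv (- (`|M| + 1)) (`|M| + 1) f2.
move=> /integrableP[_]; apply: le_lt_trans.
apply: ge0_subset_integral => //=.
- exact: compact_measurable.
- apply/measurable_EFinP; apply: measurableT_comp => //.
  exact: measurable_funS mf.
- by move=> x /KM; rewrite /= in_itv/= -ler_norml.
Qed.

Lemma ae_imply (P Q : R -> Prop) : (forall x, P x -> Q x) ->
  {ae mu, forall x, P x} -> {ae mu, forall x, Q x}.
Proof.
move=> PQ [N [mN N0 PN]]; exists N; split => //.
by move=> x /= nQ; apply: PN => /= /PQ.
Qed.

Lemma ae_and (P Q : R -> Prop) : {ae mu, forall x, P x} ->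
  {ae mu, forall x, Q x} -> {ae mu, forall x, P x /\ Q x}.
Proof.
move=> [N [mN N0 PN]] [M [mM M0 QM]]; exists (N `|` M); split.
- exact: measurableU.
- by apply: null_set_setU.
- move=> x /= nPQ; have [/PN|nP] := pselect (~ P x); first by left.
  by right; apply: QM => /= Qx; apply: nPQ; split => //; exact: contrapT.
Qed.

Lemma ae_exists_itv (P : R -> Prop) (a b : R) : a < b ->
  {ae mu, forall x, P x} -> exists x, a < x < b /\ P x.
Proof.
move=> ab [N [mN N0 PN]]; apply: contrapT => nex.
have : (mu `]a, b[ <= mu N)%E.
  apply: le_measure; rewrite ?inE//.
  move=> x /=; rewrite in_itv/= => xab; apply: PN => /= Px; apply: nex.
  by exists x.
rewrite [X in (_ <= X)%E]N0 lebesgue_measure_itv/= lte_fin ab.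
by rewrite -EFinB lee_fin subr_le0 leNgt ab.
Qed.

Lemma ae_eq_continuous f g : continuous f -> continuous g ->
  {ae mu, forall x, f x = g x} -> f = g.
Proof.
move=> cf cg fg; apply/funext => x; apply: contrapT => nfg.
have d0 : 0 < `|f x - g x| by rewrite normr_gt0 subr_eq0; exact/eqP.
have cd : {for x, continuous (fun y => f y - g y)}.
  by apply: continuousB; [exact: cf|exact: cg].
have : \forall y \near x, f y - g y != 0.
  by apply: cvgr_neq0 cd _; rewrite subr_eq0; exact/eqP.
move=> [e /= e0 He].
have xe : x < x + e by rewrite ltrDl.
have [y [/andP[y1 y2] fgy]] := ae_exists_itv xe fg.
have := He y; rewrite fgy subrr eqxx /ball/= => H.
have /H // : `|x - y| < e.
by rewrite ltr0_norm ?subr_lt0// opprB ltrBlDl.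
Qed.

End LocalL2.

(** * Weak derivatives and primitives *)

Section RightLimit.
Context {R : realType}.
Implicit Types h : R -> R.

Definition lim0 h (L : R) := forall d, 0 < d ->
  exists2 e0, 0 < e0 & forall e, 0 < e < e0 -> `|h e - L| <= d.

Lemma lim0_unique h (L M : R) : lim0 h L -> lim0 h M -> L = M.
Proof.
move=> hL hM; apply/eqP; rewrite -subr_eq0 -normr_eq0 eq_le normr_ge0 andbT.
apply/ler_addgt0Pl => d d0; rewrite addr0.
have [e e0 He] := hL (d / 2) (divr_gt0 d0 (ltr0n _ 2)).
have [e' e'0 He'] := hM (d / 2) (divr_gt0 d0 (ltr0n _ 2)).
pose k := Num.min e e' / 2.
have k0 : 0 < k by rewrite divr_gt0// lt_min e0.
have : k < Num.min e e' by rewrite ltr_pdivrMr ?ltr_pMr ?ltr1n// lt_min e0.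
rewrite lt_min => /andP[ke ke'].
have := He k; rewrite k0 ke => /(_ isT) h1.
have := He' k; rewrite k0 ke' => /(_ isT) h2.
have -> : L - M = - (h k - L) + (h k - M) by ring.
by apply: le_trans (ler_normD _ _) _; rewrite normrN; lra.
Qed.

Lemma lim0D h k (L M : R) : lim0 h L -> lim0 k M -> lim0 (fun e => h e + k e) (L + M).
Proof.
move=> hL hM d d0.
have [e e0 He] := hL (d / 2) (divr_gt0 d0 (ltr0n _ 2)).
have [e' e'0 He'] := hM (d / 2) (divr_gt0 d0 (ltr0n _ 2)).
exists (Num.min e e'); first by rewrite lt_min e0.
move=> x /andP[x0]; rewrite lt_min => /andP[xe xe'].
have := He x; rewrite x0 xe => /(_ isT) h1.
have := He' x; rewrite x0 xe' => /(_ isT) h2.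
have -> : h x + k x - (L + M) = (h x - L) + (k x - M) by ring.
by apply: le_trans (ler_normD _ _) _; lra.
Qed.

Lemma lim0N h (L : R) : lim0 h L -> lim0 (fun e => - h e) (- L).
Proof.
move=> hL d /hL[e e0 He]; exists e => // x /He.
by rewrite -opprD normrN.
Qed.

End RightLimit.

(** * One-sided mollification at a scale [e] tending to zero *)

Section Averages.
Context {R : realType}.
Local Notation mu := (@lebesgue_measure R).
Local Notation step := (@smooth_step R).
Variables (dS : R -> R) (C : R).
Hypothesis dSP : forall x : R, is_derive x 1 step (dS x).
Hypothesis dS_cont : continuous dS.
Hypothesis dS_out : forall x, x < 0 \/ 1 < x -> dS x = 0.
Hypothesis C0 : 0 < C.
Hypothesis dS_bound : forall x, `|dS x| <= C.
Implicit Types f g : R -> R.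

Let arg (e x z : R) := - (e^-1 * x) + e^-1 * z.

Let argE e x z : arg e x z = e^-1 * (z - x).
Proof. by rewrite /arg mulrBr addrC. Qed.

(** The [z]-derivative of the step rescaled to [[x, x + e]]: a one-sided mollifier with integral
    one. *)
Definition kernel (e x z : R) := e^-1 * dS (arg e x z).

Definition average f (e x : R) := \int[mu]_z (f z * kernel e x z).

(** A smooth approximation of the indicator of [[x, y]] for [x < y], and a primitive of the
    difference of the kernels at [x] and [y]. *)
Definition bump (e x y z : R) := step (arg e x z) - step (arg e y z).

Lemma arg_le0 e x z : 0 < e -> z <= x -> arg e x z <= 0.
Proof. by move=> e0 zx; rewrite argE pmulr_rle0 ?invr_gt0// subr_le0. Qed.

Lemma arg_ge1 e x z : 0 < e -> x + e <= z -> 1 <= arg e x z.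
Proof. by move=> e0 zx; rewrite argE ler_pdivlMl// mulr1 lerBrDl. Qed.

Lemma bump_derive e x y (z : R) :
  is_derive z 1 (bump e x y) (kernel e x z - kernel e y z).
Proof.
apply: is_derive_subf; rewrite /kernel mulrC;
  exact: (is_derive_compf (dSP _) (is_derive_affine _ _ _)).
Qed.

Lemma bump_test e x y : 0 < e -> test_fun (bump e x y).
Proof.
move=> e0; split.
  move=> n; apply: Cn_derivable.
  rewrite (_ : bump e x y = (fun z => step (arg e x z) + (-1) * step (arg e y z))).
    apply: CnD; last apply: CnZ; exact: Cn_affine (Cn_smooth_step _).
  by apply/funext => z; rewrite mulN1r.
exists (`|x| + `|y| + e) => z.
have := ler_norm x; have := ler_norm y; have := ler_norm (- x).
have := ler_norm (- y); rewrite !normrN => ? ? ? ?.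
have nx := normr_ge0 x; have ny := normr_ge0 y.
rewrite ltr_normr => /orP[] zb; rewrite /bump.
  by rewrite !smooth_step_ge1 ?subrr// arg_ge1//; lra.
by rewrite !smooth_step_le0 ?subrr// arg_le0//; lra.
Qed.

Lemma kernel_continuous e x : continuous (kernel e x).
Proof.
move=> z; apply: cvgM; first exact: cvg_cst.
apply: (continuous_comp (is_derive_continuous (is_derive_affine _ _ z))).
exact: dS_cont.
Qed.

Lemma kernel_bound e x z : 0 < e -> `|kernel e x z| <= e^-1 * C.
Proof.
by move=> e0; rewrite normrM gtr0_norm ?invr_gt0// ler_wpM2l// invr_ge0 ltW.
Qed.

Lemma kernel_out e x z : 0 < e -> z \notin `[x, x + e] -> kernel e x z = 0.
Proof.
move=> e0; rewrite in_itv/= negb_and -!ltNge /kernel argE => zI.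
rewrite dS_out ?mulr0//; case/orP: zI => zI; [left|right].
  by rewrite pmulr_rlt0 ?invr_gt0// subr_lt0.
by rewrite ltr_pdivlMl// mulr1 ltrBrDl.
Qed.

Lemma kernel_integrable f e x : 0 < e -> L2 f ->
  mu.-integrable setT (EFin \o (fun z => f z * kernel e x z)).
Proof.
move=> e0 f2; apply: (@L2_mul_integrable _ _ _ x (x + e) (e^-1 * C)) => //.
- exact: continuous_measurable_fun (@kernel_continuous e x).
- by move=> z; exact: kernel_bound.
- by move=> z; exact: kernel_out.
Qed.

(* The kernel is the derivative of a smooth step, so a difference of two averages
   pairs [f] with the derivative of a test function approximating an indicator. *)
Lemma average_sub f g e x y : 0 < e -> L2 f -> weak_deriv f g ->
  average f e y - average f e x = \int[mu]_z (g z * bump e x y z).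
Proof.
move=> e0 f2 fg; have := fg _ (bump_test x y e0).
move=> /(congr1 fine); rewrite fineN => H.
rewrite -[RHS]opprK -[in RHS]H -opprB; congr (- _).
rewrite /average -RintegralB//; [|exact: kernel_integrable..].
apply: eq_Rintegral => z _.
by rewrite (is_derive_derive1 (bump_derive _ _ _ _)) mulrBr.
Qed.

Lemma L2_norm f : L2 f -> L2 (fun x => `|f x|).
Proof.
move=> [mf foo]; split; first exact: measurableT_comp.
by under eq_integral do rewrite real_normK ?num_real//.
Qed.

Lemma indic_integrable f a b : L2 f ->
  mu.-integrable setT (EFin \o (fun z => f z * \1_`[a, b] z)).
Proof.
move=> f2; apply: (@L2_mul_integrable _ _ _ a b 1) => //.
- by move=> x; rewrite indicE; case: (_ \in _); rewrite ?normr1 ?normr0.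
- by move=> x xab; rewrite indicE mem_setE (negbTE xab).
Qed.

(** The two functions differ only on the transition layers of length [e] to the right of [x] and
    [y], which may overlap. *)
Lemma bump_indic e x y z : 0 < e -> x < y ->
  `|bump e x y z - \1_`[x, y] z| <= \1_`[x, x + e] z + \1_`[y, y + e] z.
Proof.
move=> e0 xy; rewrite !indicE !mem_setE !in_itv/= /bump.
have T1 : true%:R = 1 :> R by [].
have F0 : false%:R = 0 :> R by [].
have /andP[a0 a1] := smooth_step01 (arg e x z).
have /andP[b0 b1] := smooth_step01 (arg e y z).
have [zx|xz] := ltP z x.
  rewrite !smooth_step_le0 ?arg_le0 ?(ltW zx)//; last exact: ltW (lt_trans zx xy).
  by rewrite subrr subr0 normr0 addr_ge0.
have [zxe|xez] := leP z (x + e); have [zy|yz] := ltP z y; rewrite /=.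
- rewrite (smooth_step_le0 (arg_le0 _ (ltW zy)))// (ltW zy) subr0 addr0.
  by rewrite ?T1 ?F0 ler_norml; apply/andP; split; lra.
- have [zye|yez] := leP z (y + e); last first.
    by rewrite !smooth_step_ge1 ?arg_ge1 ?(ltW yez)//; lra.
  by case: (z <= y); rewrite ?T1 ?F0 ler_norml; apply/andP; split; lra.
- rewrite (smooth_step_le0 (arg_le0 _ (ltW zy)))// (ltW zy) subr0 addr0.
  by rewrite smooth_step_ge1 ?arg_ge1 ?(ltW xez)// subrr normr0.
- have [zye|yez] := leP z (y + e); last first.
    rewrite !smooth_step_ge1 ?arg_ge1 ?(ltW yez) ?(ltW xez)//.
    have -> : (z <= y) = false by apply/negP => ?; lra.
    by rewrite ?F0 subrr subr0 normr0 addr0.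
  rewrite (smooth_step_ge1 (arg_ge1 _ (ltW xez)))//.
  by case: (z <= y); rewrite ?T1 ?F0 ler_norml; apply/andP; split; lra.
Qed.

(** The error is an integral of [|g|] over two layers of length [e], which is small because [g] is
    square integrable. *)
Lemma average_sub_lim f g x y : L2 f -> L2 g -> weak_deriv f g -> x < y ->
  lim0 (fun e => average f e y - average f e x) (\int[mu]_(z in `[x, y]) g z).
Proof.
move=> f2 g2 fg xy d d0.
pose N := fine (\int[mu]_z ((g z ^+ 2)%:E)).
have N0 : 0 <= N by rewrite fine_ge0// integral_ge0// => z _; rewrite lee_fin sqr_ge0.
have gN : (\int[mu]_z ((g z ^+ 2)%:E) <= N%:E)%E.
  by rewrite fineK// (integrable_fin_num measurableT (L2_sq_integrable g2)).
(* The two layers contribute [eta e + N / eta] in total: [eta] is large enough for the second term,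
   then [e] small enough for the first. *)
pose eta := 2 * N / d + 1.
have eta0 : 0 < eta by rewrite ltr_wpDl// divr_ge0 ?mulr_ge0// ltW.
exists (d / (2 * eta)); first by rewrite divr_gt0// mulr_gt0.
move=> e /andP[e0 ed].
rewrite (average_sub _ _ e0 f2 fg) Rintegral_mul_indic.
have bI : mu.-integrable setT (EFin \o (fun z => g z * bump e x y z)).
  apply: (@L2_mul_integrable _ _ _ x (y + e) 1) => //.
  - apply: continuous_measurable_fun => z.
    exact: is_derive_continuous (bump_derive _ _ _ _).
  - move=> z; have /andP[? ?] := smooth_step01 (arg e x z).
    have /andP[? ?] := smooth_step01 (arg e y z).
    by rewrite /bump ler_norml; apply/andP; split; lra.
  - move=> z; rewrite in_itv/= negb_and -!ltNge => /orP[zx|yz]; rewrite /bump.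
      by rewrite !smooth_step_le0 ?subrr ?arg_le0//; lra.
    by rewrite !smooth_step_ge1 ?subrr ?arg_ge1//; lra.
rewrite -RintegralB//; last exact: indic_integrable.
have i1 := indic_integrable x (x + e) (L2_norm g2).
have i2 := indic_integrable y (y + e) (L2_norm g2).
apply: (@le_trans _ _ (\int[mu]_z
    (`|g z| * \1_`[x, x + e] z + `|g z| * \1_`[y, y + e] z))).
  have iB := integrableB measurableT bI (indic_integrable x y g2).
  apply: le_trans (le_normr_Rintegral _ iB) _ => //.
  apply: le_Rintegral => //; first exact: integrable_norm iB.
    exact: (integrableD measurableT i1 i2).
  move=> z _ /=; rewrite -mulrBr -mulrDr normrM ler_wpM2l//.
  exact: bump_indic.
rewrite RintegralD// -!Rintegral_mul_indic.
have b1 := L2_itv_bound g2 gN (ler_wpDr (ltW e0) (lexx x)) eta0.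
have b2 := L2_itv_bound g2 gN (ler_wpDr (ltW e0) (lexx y)) eta0.
have h1 : N / eta <= d / 2.
  rewrite ler_pdivrMr// /eta mulrDr mulr1.
  have -> : d / 2 * (2 * N / d) = N by field; rewrite gt_eqF.
  by rewrite lerDl divr_ge0// ltW.
have h2 : eta * e <= d / 2.
  move: ed; rewrite ltr_pdivlMr ?mulr_gt0// => h; nra.
have ex v : v + e - v = e by rewrite addrAC subrr add0r.
rewrite !ex in b1 b2; lra.
Qed.

Lemma kernel_integral e x : 0 < e -> \int[mu]_z kernel e x z = 1.
Proof.
move=> e0.
have -> : \int[mu]_z kernel e x z = \int[mu]_(z in `[x, x + e]) kernel e x z.
  rewrite Rintegral_mul_indic; apply: eq_Rintegral => z _.
  rewrite indicE mem_setE; case: (boolP (z \in `[x, x + e])) => [_|zI]; first by rewrite mulr1.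
  by rewrite (@kernel_out e x z e0 zI) mul0r.
have dF (z : R) : is_derive z 1 (fun z => step (arg e x z)) (kernel e x z).
  rewrite /kernel mulrC; exact: (is_derive_compf (dSP _) (is_derive_affine _ _ _)).
have cF z : {for z, continuous (fun z => step (arg e x z))}.
  exact: is_derive_continuous (dF z).
rewrite /Rintegral (@continuous_FTC2 _ _ (fun z => step (arg e x z))) ?ltrDl//.
- rewrite -EFinB/= smooth_step_ge1 ?arg_ge1// smooth_step_le0 ?arg_le0//.
  by rewrite subr0.
- by apply: continuous_subspaceT; exact: kernel_continuous.
- split.
  + by move=> z _; case: (dF z).
  + by apply: cvg_at_right_filter; exact: cF.
  + by apply: cvg_at_left_filter; exact: cF.
- by move=> z _; exact: is_derive_derive1.
Qed.

(** The kernel has mass one and is at most [C / e] on [[x, x + e]], so the error is dominated by a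
    mean of [|f - f x|] over a ball of comparable size. *)
Lemma average_lebesgue_pt f x : L2 f -> lebesgue_pt f x ->
  lim0 (fun e => average f e x) (f x).
Proof.
move=> f2 fx d d0.
(* The ball of radius [2 e] has measure [4 e] and, being open, contains [x + e]; multiplying by
   [C / e] gives [4 C d' = d]. *)
pose d' := d / (4 * C).
have d'0 : 0 < d' by rewrite divr_gt0// mulr_gt0.
have [e0 /= e00 He] : \forall r \near (0 : R)^'+, (davg f x r < d'%:E)%E.
  apply: (fx [set y | (y < d'%:E)%E]); apply: open_nbhs_nbhs; split.
    exact: open_ereal_lt_ereal.
  by rewrite /= lte_fin.
exists (e0 / 2); first by rewrite divr_gt0.
move=> e /andP[e_gt0 ee0].
have := He (2 * e); rewrite /ball/= sub0r normrN gtr0_norm ?mulr_gt0//.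
have e20 : 0 < 2 * e by rewrite mulr_gt0.
have -> : 2 * e < e0 by move: ee0; rewrite ltr_pdivlMr// mulrC.
move=> /(_ isT isT); rewrite /davg /iavg lebesgue_measure_ball ?(ltW e20)//.
have n0 : (2 * e) *+ 2 != 0 by rewrite mulrn_eq0/= gt_eqF.
rewrite inver (negbTE n0) => Hd.
have {Hd} Hb : (\int[mu]_(y in ball x (2 * e)) `|f y - f x|%:E <= (4 * e * d')%:E)%E.
  move: Hd; rewrite lte_pdivrMl ?pmulrn_lgt0// => /ltW; rewrite -EFinM.
  by have -> : (2 * e) *+ 2 * d' = 4 * e * d' by ring.
have [mf _] := f2.
pose h z := f z - f x.
have mh : measurable_fun setT h by exact: measurable_funB.
have hi : mu.-integrable `[x, x + e] (EFin \o h).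
  exact: (integrableB _ (L2_integrable_itv _ _ f2) (cst_integrable_itv _ _ (f x))).
have ki : mu.-integrable setT (EFin \o (kernel e x)).
  have := @mul_integrable_itv _ (cst 1) (kernel e x) x (x + e) (e^-1 * C).
  rewrite (_ : (fun z => cst 1 z * kernel e x z) = kernel e x); last first.
    by apply/funext => z /=; rewrite mul1r.
  apply => //; first exact: cst_integrable_itv.
  - exact: continuous_measurable_fun (@kernel_continuous e x).
  - by move=> z; exact: kernel_bound.
  - by move=> z; exact: kernel_out.
have hki : mu.-integrable setT (EFin \o (fun z => h z * kernel e x z)).
  apply: (@mul_integrable_itv _ _ _ x (x + e) (e^-1 * C)) => //.
  - exact: continuous_measurable_fun (@kernel_continuous e x).
  - by move=> z; exact: kernel_bound.
  - by move=> z; exact: kernel_out.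
have kxi : mu.-integrable setT (EFin \o (fun z => f x * kernel e x z)).
  exact: (integrableZl measurableT (f x) ki).
have -> : average f e x - f x = \int[mu]_z (h z * kernel e x z).
  rewrite -[X in _ - X]mulr1 -(kernel_integral x e_gt0) -RintegralZl//.
  rewrite -RintegralB//; last exact: kernel_integrable.
  by apply: eq_Rintegral => z _; rewrite /h mulrBl.
have hI : mu.-integrable setT (EFin \o (fun z => `|h z| * \1_`[x, x + e] z)).
  apply: (@mul_integrable_itv _ _ _ x (x + e) 1) => //.
  - exact: measurableT_comp.
  - exact: integrable_norm hi.
  - by move=> z; rewrite indicE; case: (_ \in _); rewrite ?normr1 ?normr0.
  - by move=> z zab; rewrite indicE mem_setE (negbTE zab).
apply: le_trans (le_normr_Rintegral _ hki) _ => //.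
apply: (@le_trans _ _ (\int[mu]_z ((e^-1 * C) * (`|h z| * \1_`[x, x + e] z)))).
  apply: le_Rintegral => //.
  - exact: integrable_norm hki.
  - exact: (integrableZl measurableT (e^-1 * C) hI).
  - move=> z _; rewrite normrM mulrCA ler_wpM2l// indicE mem_setE.
    case: (boolP (z \in `[x, x + e])) => [_|zI]; first by rewrite mulr1 kernel_bound.
    by rewrite (@kernel_out e x z e_gt0 zI) normr0 mulr0.
rewrite RintegralZl// -Rintegral_mul_indic.
have -> : d = e^-1 * C * (4 * e * d').
  by rewrite /d'; field; rewrite !gt_eqF.
rewrite ler_wpM2l ?mulr_ge0 ?invr_ge0 ?(ltW e_gt0) ?(ltW C0)//.
rewrite -lee_fin fineK; last first.
  exact: (integrable_fin_num _ (integrable_norm hi)).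
apply: le_trans Hb; apply: ge0_subset_integral => //.
- exact: measurable_ball.
- apply/measurable_EFinP; apply: measurableT_comp => //.
  exact: measurable_funS mh.
- move=> z /=; rewrite in_itv/= /ball/= => /andP[z1 z2].
  rewrite distrC ger0_norm ?subr_ge0//; lra.
Qed.

(** Differences of averages converge for any two points, so convergence at one Lebesgue point of [f]
    propagates to every [x]. *)
Lemma average_cvg f g : L2 f -> L2 g -> weak_deriv f g ->
  forall x, exists L, lim0 (fun e => average f e x) L.
Proof.
move=> f2 g2 fg x.
have [y [_ fy]] := ae_exists_itv (ltr01 : (0 : R) < 1)
  (lebesgue_differentiation (L2_locally_integrable f2)).
have Ly := average_lebesgue_pt f2 fy.
have [xy|yx|->] := ltgtP x y; last by exists (f y).
- have H := lim0D Ly (lim0N (average_sub_lim f2 g2 fg xy)).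
  exists (f y - \int[mu]_(z in `[x, y]) g z).
  by move=> d /H[e e0 He]; exists e => // k /He; rewrite subKr.
- have H := lim0D Ly (average_sub_lim f2 g2 fg yx).
  exists (f y + \int[mu]_(z in `[y, x]) g z).
  by move=> d /H[e e0 He]; exists e => // k /He; rewrite [average f k y + _]addrC subrK.
Qed.

(** The representative is the limit of the averages: its increments are integrals of [g], and it
    equals [f] at the Lebesgue points of [f]. *)
Lemma average_primitive f g : L2 f -> L2 g -> weak_deriv f g ->
  exists2 F : R -> R, (forall x y, x <= y -> F y - F x = \int[mu]_(z in `[x, y]) g z) &
    {ae mu, forall x, f x = F x}.
Proof.
move=> f2 g2 fg; have [F HF] := choice (average_cvg f2 g2 fg).
exists F.
  move=> x y; rewrite le_eqVlt => /orP[/eqP ->|xy].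
    by rewrite subrr set_itv1 Rintegral_set1.
  exact: lim0_unique (lim0D (HF y) (lim0N (HF x))) (average_sub_lim f2 g2 fg xy).
have := lebesgue_differentiation (L2_locally_integrable f2).
apply: ae_imply => x fx; exact: lim0_unique (average_lebesgue_pt f2 fx) (HF x).
Qed.

End Averages.

(** * Continuity and differentiability of primitives *)

Section Representatives.
Context {R : realType}.
Local Notation mu := (@lebesgue_measure R).
Implicit Types f g F G : R -> R.

Definition primitive F g :=
  forall x y, x <= y -> F y - F x = \int[mu]_(z in `[x, y]) g z.

Lemma weak_deriv_primitive f g : L2 f -> L2 g -> weak_deriv f g ->
  exists2 F, primitive F g & {ae mu, forall x, f x = F x}.
Proof.
have [dS [C [dSP dSc dSo C0 dSb]]] := @smooth_step_derive R.
exact: (average_primitive dSP dSc dSo C0 dSb).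
Qed.

Lemma L2_bounded g : L2 g -> exists2 N, 0 <= N &
  (\int[mu]_x ((g x ^+ 2)%:E) <= N%:E)%E.
Proof.
move=> g2; exists (fine (\int[mu]_z ((g z ^+ 2)%:E))).
  by rewrite fine_ge0// integral_ge0// => z _; rewrite lee_fin sqr_ge0.
by rewrite fineK// (integrable_fin_num measurableT (L2_sq_integrable g2)).
Qed.

Lemma primitive_bound F g (N eta x y : R) : primitive F g -> L2 g ->
  (\int[mu]_x ((g x ^+ 2)%:E) <= N%:E)%E -> 0 < eta ->
  `|F y - F x| <= (eta * `|y - x| + N / eta) / 2.
Proof.
move=> Fg g2 gN eta0.
wlog xy : x y / x <= y => [H|].
  have [/H//|/ltW/H] := leP x y.
  by rewrite distrC [`|x - y|]distrC.
rewrite (Fg _ _ xy) [`|y - x|]ger0_norm ?subr_ge0//.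
exact: L2_itv_bound_norm.
Qed.

Lemma primitive_continuous F g : primitive F g -> L2 g -> continuous F.
Proof.
move=> Fg g2 x; have [N N0 gN] := L2_bounded g2.
apply/cvgrPdist_lt => d d0.
pose eta := N / d + 1.
have eta0 : 0 < eta by rewrite ltr_wpDl// divr_ge0// ltW.
near=> y.
rewrite distrC (le_lt_trans (primitive_bound _ _ Fg g2 gN eta0))//.
have h1 : N / eta < d.
  by rewrite ltr_pdivrMr// /eta mulrDr mulrC divfK ?gt_eqF// mulr1 ltrDl.
have h2 : eta * `|y - x| < d.
  rewrite -ltr_pdivlMl// distrC; near: y.
  by apply: cvgr_dist_lt; [exact: cvg_id|rewrite mulr_gt0// invr_gt0].
lra.
Unshelve. all: by end_near. Qed.

Lemma primitive_ae F g G : primitive F g -> L2 g -> continuous G ->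
  {ae mu, forall x, g x = G x} -> primitive F G.
Proof.
move=> Fg [mg _] cG gG x y xy; rewrite Fg// /Rintegral; congr fine.
apply: ae_eq_integral => //.
- by apply/measurable_EFinP; exact: measurable_funS mg.
- apply/measurable_EFinP; apply: measurable_funS (continuous_measurable_fun cG) => //.
- by apply: ae_imply gG => z /= + _ => ->.
Qed.

Lemma primitive_is_derive F G : continuous G -> primitive F G ->
  forall x : R, is_derive x 1 F (G x).
Proof.
move=> cG FG x.
have xu : x < x + 1 by rewrite ltrDl.
have gi : mu.-integrable `[x - 1, x + 1] (EFin \o G).
  apply: continuous_compact_integrable; first exact: segment_compact.
  exact: continuous_subspaceT.
have ax : x - 1 < x by rewrite ltrBlDr ltrDl.
have [d1 d2] := continuous_FTC1_closed xu gi ax (cG x).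
pose I y := \int[mu]_(t in `[x - 1, y]) G t.
have dI : is_derive x 1 I (G x) by rewrite -d2; exact: derivable_is_derive.
have H := is_derive_addf (is_derive_cstf (F (x - 1)) x) dI.
apply: (@is_derive_eq _ _ _ _ _ _ _ (0 + G x)); last exact: add0r.
apply: near_eq_is_derive H; near=> y.
rewrite /I -FG; first by rewrite addrC subrK.
by apply: ltW; near: y; exact: lt_nbhsr.
Unshelve. all: by end_near. Qed.

End Representatives.

(** * C^1 representatives of Sobolev functions *)

Section SobolevC1.
Context {R : realType}.
Local Notation mu := (@lebesgue_measure R).
Implicit Types f g F G : R -> R.

(** Chebyshev's inequality on an interval. *)
Lemma L2_lower_bound F (N K a b : R) : measurable_fun setT F ->
  (\int[mu]_x ((F x ^+ 2)%:E) <= N%:E)%E -> a <= b ->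
  (forall x, a <= x <= b -> K <= F x ^+ 2) -> 0 <= K -> K * (b - a) <= N.
Proof.
move=> mF FN ab FK K0; rewrite -lee_fin; apply: le_trans FN.
have mF2 : measurable_fun setT (fun x => ((F x ^+ 2)%:E)).
  by apply/measurable_EFinP; exact: measurable_funX.
apply: (@le_trans _ _ (\int[mu]_(x in `[a, b]) ((F x ^+ 2)%:E))%E); last first.
  apply: ge0_subset_integral => //.
  by move=> x _; rewrite lee_fin sqr_ge0.
rewrite EFinM -(lebesgue_itv ab) -integral_cst//.
apply: ge0_le_integral => //.
exact: measurable_funS mF2.
Qed.

(** The embedding of [H^1] into bounded functions. On [[x, x + 1]] the function varies by at most
    [e], so [|F x| > 2 e] would keep [|F|] above a constant larger than [e] on an interval of length
    one. *)
Lemma primitive_sup_bound F g (e : R) : 0 < e -> primitive F g -> L2 g -> L2 F ->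
  (\int[mu]_x ((F x ^+ 2)%:E) <= (e ^+ 2)%:E)%E ->
  (\int[mu]_x ((g x ^+ 2)%:E) <= (e ^+ 2)%:E)%E -> forall x, `|F x| <= 2 * e.
Proof.
move=> e0 Fg g2 [mF _] FN gN x; rewrite leNgt; apply/negP => Fx.
pose K := `|F x| - e.
have eK : e < K by rewrite /K; lra.
have H : K ^+ 2 * (x + 1 - x) <= e ^+ 2.
  apply: (L2_lower_bound mF FN); rewrite ?lerDl ?sqr_ge0//.
  move=> y /andP[xy yx].
  have := primitive_bound x y Fg g2 gN e0.
  rewrite [`|y - x|]ger0_norm ?subr_ge0// expr2 mulfK ?gt_eqF// => Fxy.
  have Ky : K <= `|F y|.
    have := ler_normB (F y) (F y - F x); rewrite subKr /K.
    have : e * (y - x) <= e by rewrite ger_pMr//; lra.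
    lra.
  rewrite -(real_normK (num_real (F y))) lerXn2r ?nnegrE//.
  exact: ltW (lt_trans e0 eK).
have : e ^+ 2 < K ^+ 2 by rewrite ltrXn2r// ?nnegrE ltW// (lt_trans e0).
have E1 : x + 1 - x = 1 by rewrite addrAC subrr add0r.
by rewrite E1 mulr1 in H; rewrite ltNge H.
Qed.

(** On an interval of length [1 / e] inside the half-line Chebyshev's inequality reads [c^2 <= N e],
    for every [e > 0]. *)
Lemma L2_constant_half_line F (c a : R) : L2 F ->
  (forall x, x < a -> F x = c) \/ (forall x, a < x -> F x = c) -> c = 0.
Proof.
move=> F2 Fc; have [N N0 FN] := L2_bounded F2; have [mF _] := F2.
apply/eqP; rewrite -sqrf_eq0 eq_le sqr_ge0 andbT.
apply: (@le0_of_le_scale _ _ N) => e e0; rewrite -ler_pdivrMr//.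
case: Fc => Fc.
  have -> : e^-1 = (a - 1) - (a - 1 - e^-1) by ring.
  apply: (L2_lower_bound mF FN); rewrite ?sqr_ge0//.
    by rewrite lerBlDr lerDl invr_ge0 ltW.
  by move=> x /andP[_ xa]; rewrite Fc//; lra.
have -> : e^-1 = (a + 1 + e^-1) - (a + 1) by ring.
apply: (L2_lower_bound mF FN); rewrite ?sqr_ge0//.
  by rewrite lerDl invr_ge0 ltW.
by move=> x /andP[xa _]; rewrite Fc//; lra.
Qed.

Definition C1_rep f F G := [/\ forall x : R, is_derive x 1 F (G x), continuous G &
  {ae mu, forall x, f x = F x}].

Lemma C1_rep_continuous f F G : C1_rep f F G -> continuous F.
Proof. by move=> [FG _ _] x; exact: is_derive_continuous (FG x). Qed.

Lemma C1_rep_unique f F G F' G' : C1_rep f F G -> C1_rep f F' G' ->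
  F = F' /\ G = G'.
Proof.
move=> r r'; have FF' : F = F'.
  apply: ae_eq_continuous (C1_rep_continuous r) (C1_rep_continuous r') _.
  case: r r' => [_ _ H] [_ _ H'].
  by apply: ae_imply (ae_and H H') => x [<-].
split => //; apply/funext => x; case: r r' => [dF _ _] [dF' _ _].
by rewrite -(is_derive_derive1 (dF x)) -(is_derive_derive1 (dF' x)) FF'.
Qed.

Lemma C1_repB f F G f' F' G' : C1_rep f F G -> C1_rep f' F' G' ->
  C1_rep (fun x => f x - f' x) (fun x => F x - F' x) (fun x => G x - G' x).
Proof.
move=> [dF cG fF] [dF' cG' fF']; split.
- by move=> x; exact: is_derive_subf.
- by move=> x; apply: cvgB; [exact: cG|exact: cG'].
- by apply: ae_imply (ae_and fF fF') => x [-> ->].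
Qed.

Lemma C1_repZ f F G (c : R) : C1_rep f F G ->
  C1_rep (fun x => f x * c) (fun x => c * F x) (fun x => c * G x).
Proof.
move=> [dF cG fF]; split.
- by move=> x; exact: is_derive_scalef.
- by move=> x; apply: cvgM; [exact: cvg_cst|exact: cG].
- by apply: ae_imply fF => x ->; rewrite mulrC.
Qed.

Lemma ae_eq_integral_sq f F : measurable_fun setT f -> measurable_fun setT F ->
  {ae mu, forall x, f x = F x} ->
  (\int[mu]_x ((F x ^+ 2)%:E) = \int[mu]_x ((f x ^+ 2)%:E))%E.
Proof.
move=> mf mF fF; apply: ae_eq_integral => //.
- by apply/measurable_EFinP; exact: measurable_funX.
- by apply/measurable_EFinP; exact: measurable_funX.
- by apply: ae_imply fF => x -> _.
Qed.

Lemma C1_rep_L2 f F G : L2 f -> C1_rep f F G -> L2 F.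
Proof.
move=> [mf foo] r; have mF := continuous_measurable_fun (C1_rep_continuous r).
case: r => _ _ fF; split => //.
by rewrite /leb (ae_eq_integral_sq mf mF fF).
Qed.

Lemma gagliardo_sq_ge0 (s : R) g : (0 <= gagliardo_sq s g)%E.
Proof.
apply: integral_ge0 => x _; apply: integral_ge0 => y _.
by rewrite lee_fin divr_ge0 ?sqr_ge0// powR_ge0.
Qed.

Lemma Hm_sq_le_H2 (m : R) f c : 2 < m -> Hm_sq_le m f c ->
  exists g1 g2, [/\ L2 f, L2 g1, L2 g2, weak_deriv f g1 & weak_deriv g1 g2] /\
  [/\ (\int[mu]_x ((f x ^+ 2)%:E) <= c%:E)%E,
      (\int[mu]_x ((g1 x ^+ 2)%:E) <= c%:E)%E &
      (\int[mu]_x ((g2 x ^+ 2)%:E) <= c%:E)%E].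
Proof.
move=> m2 [k [g [[km mk] g0 gL gW gc]]].
(* From [2 < m < k + 1], at least two weak derivatives are recorded. *)
have k2 : (1 < k)%N.
  by have := lt_trans m2 mk; rewrite ltr_nat ltnS.
have tail : (0 <= if m == k%:R then 0 else gagliardo_sq (m - k%:R) (g k))%E.
  by case: ifP => // _; exact: gagliardo_sq_ge0.
have term j : (j <= k)%N -> (\int[mu]_x ((g j x ^+ 2)%:E) <= c%:E)%E.
  move=> jk; apply: le_trans gc.
  rewrite (bigD1_seq j) ?mem_index_iota ?iota_uniq//=.
  rewrite -addeA leeDl// adde_ge0// sume_ge0// => i _.
  by apply: integral_ge0 => x _; rewrite lee_fin sqr_ge0.
exists (g 1%N), (g 2%N); rewrite -g0; split; split.
- exact: gL.
- by apply: gL; exact: ltnW.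
- exact: gL.
- by apply: gW; exact: ltnW.
- exact: gW.
- exact: term.
- by apply: term; exact: ltnW.
- exact: term.
Qed.

(** The sup bound for primitives is applied twice, to the pair [f], [g1] and to [g1], [g2]. The
    number [e] stands for a square root of [c], kept positive because it also serves as the free
    parameter of the AM-GM estimate. *)
Lemma Hm_C1_rep (m : R) f c : 2 < m -> Hm_sq_le m f c ->
  exists F G, [/\ C1_rep f F G, L2 F & forall e, 0 < e -> c <= e ^+ 2 ->
    forall x, `|F x| <= 2 * e /\ `|G x| <= 2 * e].
Proof.
move=> m2 /(Hm_sq_le_H2 m2)[g1 [g2 [[f2 g12 g22 fg gg] [fc g1c g2c]]]].
have [G Gg gG] := weak_deriv_primitive g12 g22 gg.
have [F Fg fF] := weak_deriv_primitive f2 g12 fg.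
have cG := primitive_continuous Gg g22.
have FG := primitive_ae Fg g12 cG gG.
have r : C1_rep f F G by split => //; exact: primitive_is_derive.
have F2 := C1_rep_L2 f2 r.
have [mf _] := f2; have [mF _] := F2; have [mg1 _] := g12.
have mG := continuous_measurable_fun cG.
have GE := ae_eq_integral_sq mg1 mG gG.
have FE := ae_eq_integral_sq mf mF fF.
have G2 : L2 G by split => //; rewrite GE; case: g12.
exists F, G; split => // e e0 ce x; split.
- apply: (primitive_sup_bound e0 FG) => //.
    by rewrite FE (le_trans fc)// lee_fin.
  by rewrite GE (le_trans g1c)// lee_fin.
- apply: (primitive_sup_bound e0 Gg) => //.
    by rewrite GE (le_trans g1c)// lee_fin.
  by rewrite (le_trans g2c)// lee_fin.
Qed.

Lemma Hm_rep_bound (m : R) f c F G e : 2 < m -> Hm_sq_le m f c -> C1_rep f F G ->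
  0 < e -> c <= e ^+ 2 -> forall x, `|F x| <= 2 * e /\ `|G x| <= 2 * e.
Proof.
move=> m2 /(Hm_C1_rep m2)[F' [G' [r' _ H]]] r e0 ce x.
by have [-> ->] := C1_rep_unique r r'; exact: H.
Qed.

End SobolevC1.

(** * Regularity in time *)

Section TimeFields.
Context {R : realType}.

Lemma clamp_lipschitz (a s t : R) : 0 <= a ->
  `|Num.max 0 (Num.min a s) - Num.max 0 (Num.min a t)| <= `|s - t|.
Proof.
move=> a0; wlog st : s t / s <= t.
  move=> H; have [/H//|/ltW/H] := leP s t.
  by rewrite distrC [`|t - s|]distrC.
rewrite distrC [`|s - t|]distrC [X in _ <= X]ger0_norm ?subr_ge0//.
have [sa|sa] := leP a s; have [ta|ta] := leP a t.
- by rewrite subrr normr0 subr_ge0.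
- by have := lt_le_trans ta (le_trans sa st); rewrite ltxx.
- rewrite (max_r a0) ler_norml; have [s0|s0] := leP 0 s; apply/andP; split; lra.
- rewrite ler_norml; have [s0|s0] := leP 0 s; have [t0|t0] := leP 0 t;
    apply/andP; split; lra.
Qed.

Lemma C1_field_weaken (F Fx Ft : R -> R -> R) (B B' T T' : R) :
  C1_field F Fx Ft B T -> B <= B' -> T' <= T -> C1_field F Fx Ft B' T'.
Proof.
move=> [cF dF dirF bF] BB TT; split => //.
- by move=> t x a b /andP[t0 tT]; apply: dirF; rewrite t0 (lt_le_trans tT).
- move=> t x /andP[t0 tT]; have [|h1 h2 h3] := bF t x.
    by rewrite t0 (le_trans tT).
  by split; exact: le_trans BB.
Qed.

Variables (m T : R) (U V : R -> R -> R).
Hypothesis m2 : 2 < m.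
Hypothesis T0 : 0 < T.
Hypothesis UV_Hm : forall t, 0 <= t <= T -> in_Hm m (U t) /\ in_Hm m (V t).
Hypothesis UV_C1 : forall t, 0 <= t <= T -> forall eps, 0 < eps ->
  exists delta, 0 < delta /\
    forall s, 0 <= s <= T -> `|s - t| < delta ->
    [/\ Hm_sq_le m (fun x => U s x - U t x) eps,
        Hm_sq_le m (fun x => V s x - V t x) eps &
        (s != t -> Hm_sq_le m
           (fun x => (U s x - U t x) / (s - t) - V t x) eps)].

(** By uniqueness, the representative of an increment or difference quotient is the same combination
    of representatives, so estimates in [H^m] become estimates uniform in [x]. [W] represents the
    time derivative. *)
Lemma time_representatives : exists F G W : R -> R -> R,
  [/\ forall t, 0 <= t <= T -> C1_rep (U t) (F t) (G t) /\ L2 (F t),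
      forall t, 0 <= t <= T -> continuous (W t),
      forall t, 0 <= t <= T -> exists M, forall x,
        [/\ `|F t x| <= M, `|G t x| <= M & `|W t x| <= M] &
      forall t, 0 <= t <= T -> forall e, 0 < e -> exists2 d, 0 < d &
        forall s, 0 <= s <= T -> `|s - t| < d -> forall x,
        [/\ `|F s x - F t x| <= e, `|G s x - G t x| <= e, `|W s x - W t x| <= e &
          `|F s x - F t x - (s - t) * W t x| <= e * `|s - t|]].
Proof.
(* Outside [[0, T]] the zero functions serve as defaults, so that choice yields functions of all
   real times. *)
have ex t : exists p : (R -> R) * (R -> R) * ((R -> R) * (R -> R)),
    0 <= t <= T -> [/\ C1_rep (U t) p.1.1 p.1.2, L2 p.1.1,
      C1_rep (V t) p.2.1 p.2.2 & exists M, forall x,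
        [/\ `|p.1.1 x| <= M, `|p.1.2 x| <= M & `|p.2.1 x| <= M]].
  have [tI|ntI] := pselect (0 <= t <= T); last first.
    by exists ((fun=> 0, fun=> 0), (fun=> 0, fun=> 0)).
  have [[c Uc] [c' Vc]] := UV_Hm tI.
  have [F [G [rF F2 bF]]] := Hm_C1_rep m2 Uc.
  have [W [X [rW W2 bW]]] := Hm_C1_rep m2 Vc.
  exists ((F, G), (W, X)) => _; split => //=.
  pose e := `|c| + `|c'| + 1.
  have e0 : 0 < e by rewrite ltr_wpDl// addr_ge0.
  have ce : c <= e ^+ 2.
    have := ler_norm c; have := normr_ge0 c; have := normr_ge0 c'; rewrite /e; nra.
  have ce' : c' <= e ^+ 2.
    have := ler_norm c'; have := normr_ge0 c; have := normr_ge0 c'; rewrite /e; nra.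
  exists (2 * e) => x; have [h1 h2] := bF e e0 ce x; have [h3 _] := bW e e0 ce' x.
  by split.
have [P HP] := choice ex.
exists (fun t => (P t).1.1), (fun t => (P t).1.2), (fun t => (P t).2.1); split.
- by move=> t /HP[].
- by move=> t /HP[_ _ /C1_rep_continuous].
- by move=> t /HP[].
move=> t tI e e0.
(* A squared norm of at most [(e / 2)^2] gives a sup bound of [2 (e / 2) = e]. *)
have eps0 : 0 < (e / 2) ^+ 2 by rewrite exprn_gt0// divr_gt0.
have e20 : 0 < e / 2 by rewrite divr_gt0.
have e2e : 2 * (e / 2) = e by rewrite mulrC divfK.
have [d [d0 Hd]] := UV_C1 tI eps0; exists d => // s sI std x.
have [HU HV HQ] := Hd s sI std.
have [rU _ rV _] := HP s sI; have [rU' _ rV' _] := HP t tI.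
have := Hm_rep_bound m2 HU (C1_repB rU rU') e20 (lexx _) x; rewrite e2e => -[h1 h2].
have := Hm_rep_bound m2 HV (C1_repB rV rV') e20 (lexx _) x; rewrite e2e => -[h3 _].
split => //; have [->|st] := eqVneq s t.
  by rewrite !subrr mul0r subrr normr0 mulr0.
have := Hm_rep_bound m2 (HQ st) (C1_repB (C1_repZ (s - t)^-1 (C1_repB rU rU')) rV')
  e20 (lexx _) x; rewrite e2e => -[h4 _].
have st0 : s - t != 0 by rewrite subr_eq0.
have -> : (P s).1.1 x - (P t).1.1 x - (s - t) * (P t).2.1 x =
  ((s - t)^-1 * ((P s).1.1 x - (P t).1.1 x) - (P t).2.1 x) * (s - t).
  by field.
by rewrite normrM ler_wpM2r.
Qed.

(* Times are clamped to [0, T'] so that joint continuity holds on the whole plane. *)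
Lemma C1_Hm_field : exists T' B F G W,
  [/\ 0 < T' < T, C1_field F G W B T',
    forall t, 0 <= t <= T' -> C1_rep (U t) (F t) (G t) /\ L2 (F t) &
    forall t, 0 <= t <= T' -> continuous (W t)].
Proof.
have [F [G [W [FG cW bFGW cont]]]] := time_representatives.
have I0 : 0 <= (0 : R) <= T by apply/andP; split => //; exact: ltW.
have [M HM] := bFGW 0 I0; have [d d0 Hd] := cont 0 I0 1 ltr01.
(* Up to time [T'] all fields stay within [1] of their initial values, hence the common bound
   [M + 1]. *)
pose T' := Num.min d T / 2.
have dT0 : 0 < Num.min d T by rewrite lt_min d0.
have T'0 : 0 < T' by rewrite divr_gt0.
have : T' < Num.min d T by rewrite ltr_pdivrMr// ltr_pMr// ltr1n.
rewrite lt_min => /andP[T'd T'T].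
pose cl (t : R) : R := Num.max 0 (Num.min T' t).
have clI t : 0 <= cl t <= T'.
  by apply/andP; rewrite /cl; split; [rewrite le_max lexx|rewrite ge_max (ltW T'0) ge_min lexx].
have clI' t : 0 <= cl t <= T.
  by have /andP[-> /= h] := clI t; rewrite (le_trans h)// ltW.
have clE t : 0 <= t <= T' -> cl t = t.
  by move=> /andP[t0 tT]; rewrite /cl (min_idPr tT); exact: max_r.
have cl_lip s t : `|cl s - cl t| <= `|s - t| := clamp_lipschitz s t (ltW T'0).
(* Continuity in space at each time and continuity in time uniformly in space give joint
   continuity. *)
have jcont (K : R -> R -> R) :
  (forall t, 0 <= t <= T -> continuous (K t)) ->
  (forall t, 0 <= t <= T -> forall e, 0 < e -> exists2 d, 0 < d &
     forall s, 0 <= s <= T -> `|s - t| < d -> forall x, `|K s x - K t x| <= e) ->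
  continuous (fun z : R * R => K (cl z.1) z.2).
  move=> cK uK [t x]; apply/cvgrPdist_lt => e e0 /=.
  have e30 : 0 < e / 3 by rewrite divr_gt0.
  have [d1 d10 H1] := uK (cl t) (clI' t) (e / 3) e30.
  have c1 : (fst z : R) @[z --> ((t, x) : R * R)] --> t by exact: cvg_fst.
  have c2 : K (cl t) (snd z) @[z --> ((t, x) : R * R)] --> K (cl t) x.
    apply: (@continuous_comp _ _ _ snd (K (cl t)) (t, x)); first exact: cvg_snd.
    exact: (cK _ (clI' t)).
  have n1 := cvgr_dist_lt _ _ c1 _ d10; have n2 := cvgr_dist_lt _ _ c2 _ e30.
  near=> z.
  have h1 : `|K (cl z.1) z.2 - K (cl t) z.2| <= e / 3.
    apply: H1 => //; apply: le_lt_trans (cl_lip _ _) _; rewrite distrC; near: z.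
    exact: n1.
  have h2 : `|K (cl t) x - K (cl t) z.2| < e / 3.
    by near: z; exact: n2.
  have -> : K (cl t) x - K (cl z.1) z.2 =
    (K (cl t) x - K (cl t) z.2) - (K (cl z.1) z.2 - K (cl t) z.2) by ring.
  by apply: le_lt_trans (ler_normB _ _) _; lra.
exists T', (M + 1), (fun t => F (cl t)), (fun t => G (cl t)), (fun t => W (cl t)).
split; first by rewrite T'0.
- split.
  + apply: jcont.
      by move=> t /FG[/C1_rep_continuous].
    move=> t tI e e0; have [d1 d10 H1] := cont t tI e e0; exists d1 => // s sI st x.
    by have [] := H1 s sI st x.
  + by move=> t x; have [[dF _ _] _] := FG _ (clI' t).
  + move=> t x a b tI; have /andP[t0 tT] := tI.
    have tI' : 0 <= t <= T' by rewrite !ltW.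
    rewrite (clE t tI').
    have tIT : 0 <= t <= T by rewrite -(clE t tI').
    have [[dF _ _] _] := FG t tIT.
    have d2 : is_derive (0 : R) 1 (fun h => F t (x + b * h)) (G t x * b).
      apply: is_derive_compf (is_derive_affine x b 0).
      by rewrite mulr0 addr0.
    (* The time increment is taken at the moving point [x + b h]. This is harmless: the first order
       remainder is uniform in space, and [W t] is continuous. *)
    have d1 : is_derive (0 : R) 1
      (fun h => F (cl (t + a * h)) (x + b * h) - F t (x + b * h)) (a * W t x).
      apply: quotient_is_derive; apply/cvgrPdist_lt => e e0.
      pose e1 := e / (2 * (`|a| + 1)).
      have a10 : 0 < `|a| + 1 by rewrite ltr_wpDl.
      have e10 : 0 < e1 by rewrite divr_gt0// mulr_gt0.
      have [d1 d10 H1] := cont t tIT e1 e10.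
      have ca : t + a * h @[h --> (0 : R)^'] --> t.
        have H : t + a * h @[h --> (0 : R)] --> t + a * 0 :=
          is_derive_continuous (is_derive_affine t a 0).
        by rewrite mulr0 addr0 in H; exact: cvg_within_filter H.
      have cx : W t (x + b * h) @[h --> (0 : R)^'] --> W t x.
        have H : W t (x + b * h) @[h --> (0 : R)] --> W t (x + b * 0).
          apply: (@continuous_comp _ _ _ (fun h => x + b * h) (W t) 0).
            exact: is_derive_continuous (is_derive_affine x b 0).
          exact: (cW _ tIT).
        by rewrite mulr0 addr0 in H; exact: cvg_within_filter H.
      have n1 := cvgr_gt _ ca _ t0; have n2 := cvgr_lt _ ca _ tT.
      have n3 := cvgr_dist_lt _ _ ca _ d10; have n4 := cvgr_dist_lt _ _ cx _ e10.
      near=> h; rewrite add0r mulr0 addr0.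
      have hn0 : h != 0 by near: h; exact: nbhs_dnbhs_neq.
      have hT1 : 0 < t + a * h by near: h; exact: n1.
      have hT2 : t + a * h < T' by near: h; exact: n2.
      rewrite (clE (t + a * h)); last by rewrite !ltW.
      have [||_ _ _ H] := H1 (t + a * h) _ _ (x + b * h).
      * by rewrite (ltW hT1) (le_trans (ltW hT2))// ltW.
      * rewrite distrC; near: h; exact: n3.
      have wx : `|W t x - W t (x + b * h)| < e1.
        by near: h; exact: n4.
      rewrite (clE t tI') subrr subr0.
      have ah : t + a * h - t = a * h by ring.
      rewrite ah in H.
      move: H; set D := F (t + a * h) (x + b * h) - F t (x + b * h) => H.
      have -> : a * W t x - h^-1 * D = a * (W t x - W t (x + b * h))
         - h^-1 * (D - a * h * W t (x + b * h)) by field.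
      apply: le_lt_trans (ler_normB _ _) _; rewrite !normrM normfV.
      have hp : 0 < `|h| by rewrite normr_gt0.
      have k1 : `|h|^-1 * `|D - a * h * W t (x + b * h)| <= e1 * `|a|.
        rewrite ler_pdivrMl//; apply: le_trans H _; rewrite normrM.
        by rewrite le_eqVlt; apply/orP; left; apply/eqP; ring.
      have k2 : `|a| * `|W t x - W t (x + b * h)| <= `|a| * e1 by rewrite ler_wpM2l// ltW.
      have k3 : e1 * (`|a| + 1) = e / 2 by rewrite /e1; field; rewrite gt_eqF.
      lra.
    apply: (@is_derive_eq _ _ _ _ _ _ _ (a * W t x + G t x * b)).
      rewrite (_ : (fun h => F (cl (t + a * h)) (x + b * h)) =
        fun h => (F (cl (t + a * h)) (x + b * h) - F t (x + b * h)) +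
          F t (x + b * h)); first exact: is_derive_addf d1 d2.
      by apply/funext => h; rewrite subrK.
    by rewrite [b * _]mulrC.
  + move=> t x _; have [h1 h2 h3] := HM x.
    have [||k1 k2 k3 _] := Hd (cl t) _ _ x; first exact: clI'.
      rewrite subr0 ger0_norm; first by have /andP[_ /le_lt_trans] := clI t; apply.
      by have /andP[] := clI t.
    split.
    * by rewrite -(subrK (F 0 x) (F (cl t) x)) (le_trans (ler_normD _ _))// addrC lerD.
    * by rewrite -(subrK (G 0 x) (G (cl t) x)) (le_trans (ler_normD _ _))// addrC lerD.
    * by rewrite -(subrK (W 0 x) (W (cl t) x)) (le_trans (ler_normD _ _))// addrC lerD.
- move=> t tI; rewrite (clE t tI); apply: FG.
  by rewrite -(clE t tI).
- by move=> t tI; rewrite (clE t tI); apply: cW; rewrite -(clE t tI).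
Unshelve. all: by end_near. Qed.

End TimeFields.

(** * From strong solutions to C^1 flows *)

Section Bridge.
Context {R : realType}.
Local Notation mu := (@lebesgue_measure R).

Lemma derivable_continuous (f : R -> R) :
  (forall x : R, derivable f x 1) -> continuous f.
Proof. by move=> df x; exact: is_derive_continuous (derivable_is_derive (df x)). Qed.

Lemma powR_comp_continuous (f : R -> R) (g : R) : 1 < g -> continuous f ->
  (forall x, 0 <= f x) -> continuous (fun x => f x `^ g).
Proof.
move=> g1 cf f0 x.
have [fx|fx] := ltP 0 (f x).
  apply: (@continuous_comp _ _ _ f (fun y => y `^ g)); first exact: cf.
  exact: is_derive_continuous (is_derive1_powR g fx).
have {}fx : f x = 0 by apply/eqP; rewrite eq_le fx f0.
have g0 : g != 0 by rewrite gt_eqF// (lt_trans _ g1).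
apply/cvgrPdist_lt => e e0.
have e1 : 0 < Num.min e 1 by rewrite lt_min e0/=.
have n1 := cvgr_dist_lt _ _ (cf x) _ e1.
near=> y.
have : `|f x - f y| < Num.min e 1 by near: y; exact: n1.
rewrite fx powR0// !sub0r !normrN (ger0_norm (f0 y)) ger0_norm ?powR_ge0//.
rewrite lt_min => /andP[fe f1].
have [fy|fy] := ltP 0 (f y).
  by rewrite (le_lt_trans _ fe)// ge1r_powR ?fy ?(ltW f1)// ltW.
have -> : f y = 0 by apply/eqP; rewrite eq_le fy f0.
by rewrite powR0.
Unshelve. all: by end_near. Qed.

(** If the derivatives differed, [f - g] would be nonzero at all points just to the right of [t],
    hence at some [t + d / n.+1%:R]. *)
Lemma is_derive_eq_along (f g : R -> R) (t a b d : R) : 0 < d ->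
  is_derive t 1 f a -> is_derive t 1 g b -> f t = g t ->
  (forall n : nat, f (t + d / n.+1%:R) = g (t + d / n.+1%:R)) -> a = b.
Proof.
move=> d0 fa gb ft fn; apply/eqP; rewrite -subr_eq0; apply/eqP.
have seq e : 0 < e -> exists n : nat, 0 < d / n.+1%:R < e.
  move=> e0; exists (Num.bound (d / e)); rewrite divr_gt0//= ltr_pdivrMr//.
  rewrite mulrC -ltr_pdivrMr//; apply: lt_trans (archi_boundP _) _.
    by rewrite divr_ge0// ltW.
  by rewrite ltr_nat.
have H := is_derive_subf fa gb.
case: (ltgtP (a - b) 0) => // ab.
  have [|e e0 He] := is_derive_gt0 (is_derive_oppf H); first by rewrite oppr_gt0.
  have [n ne] := seq e e0; have [_] := He _ ne.
  by rewrite fn ft !subrr ltxx.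
have [e e0 He] := is_derive_gt0 H ab.
have [n ne] := seq e e0; have [_] := He _ ne.
by rewrite fn ft !subrr ltxx.
Qed.

(** The solution agrees with its representatives only almost everywhere. The quantities [u],
    [rho * u] and the momentum flux are derivable in [x], hence continuous, so for them agreement
    holds everywhere. No continuity of [rho] in [x] is given, so the continuity equation is first
    obtained almost everywhere and then extended by continuity of the representatives. *)
Lemma CNS_flow (nu gamma m T : R) (rho0 u0 : R -> R) (rho u : R -> R -> R) :
  1 < gamma -> 2 < m -> 0 < T -> continuous rho0 -> continuous u0 ->
  (forall x, 0 <= rho0 x) -> (forall x, x <= 0 \/ 1 <= x -> rho0 x = 0) ->
  C1_Hm m T rho -> C1_Hm m T u ->
  CNS_solution nu gamma T rho0 u0 rho u ->
  exists r rx rt v vx vt B T', [/\ 0 < T',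
    flow r rx rt v vx vt B T' nu gamma, r 0 = rho0 & v 0 = u0].
Proof.
move=> g1 m2 T0 crho0 cu0 rho0_ge0 rho0_out [Vr [Hr Cr]] [Vu [Hu Cu]] [init sol].
have [T1 [B1 [r [rx [rt [/andP[T10 T1T] fr reprr crt]]]]]] :=
  C1_Hm_field m2 T0 Hr Cr.
have [T2 [B2 [v [vx [vt [/andP[T20 T2T] fv reprv cvt]]]]]] :=
  C1_Hm_field m2 T0 Hu Cu.
pose T' := Num.min T1 T2; pose B := Num.max B1 B2.
have T'0 : 0 < T' by rewrite lt_min T10.
have T'1 : T' <= T1 by rewrite ge_min lexx.
have T'2 : T' <= T2 by rewrite ge_min lexx orbT.
have {}fr : C1_field r rx rt B T'.
  by apply: C1_field_weaken fr _ T'1; rewrite le_max lexx.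
have {}fv : C1_field v vx vt B T'.
  by apply: C1_field_weaken fv _ T'2; rewrite le_max lexx orbT.
have {}reprr t : 0 <= t <= T' -> C1_rep (rho t) (r t) (rx t).
  by move=> /andP[t0 tT]; have [] := reprr t; rewrite // t0 (le_trans tT).
have {}reprv t : 0 <= t <= T' -> C1_rep (u t) (v t) (vx t) /\ L2 (v t).
  by move=> /andP[t0 tT]; apply: reprv; rewrite t0 (le_trans tT).
have {}crt t : 0 <= t <= T' -> continuous (rt t).
  by move=> /andP[t0 tT]; apply: crt; rewrite t0 (le_trans tT).
have I t : 0 < t < T' -> 0 <= t <= T' by move=> /andP[/ltW -> /ltW ->].
have IT t : 0 < t < T' -> 0 < t < T.
  by move=> /andP[-> tT]/=; rewrite (lt_trans tT)// (le_lt_trans T'1).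
have I0 : 0 <= (0 : R) <= T' by apply/andP; split => //; exact: ltW.
have rE0 : r 0 = rho0.
  apply: ae_eq_continuous => //; first exact: C1_rep_continuous (reprr 0 I0).
  have [_ _ H] := reprr 0 I0; apply: ae_imply H => x <-.
  by have [-> _] := init x.
have vE0 : v 0 = u0.
  have [rv _] := reprv 0 I0.
  apply: ae_eq_continuous => //; first exact: C1_rep_continuous rv.
  have [_ _ H] := rv; apply: ae_imply H => x <-.
  by have [_ ->] := init x.
have dr t (x : R) : is_derive x 1 (r t) (rx t x) := field_dx fr t x.
have dv t (x : R) : is_derive x 1 (v t) (vx t x) := field_dx fv t x.
have cr t : continuous (r t) by move=> x; exact: is_derive_continuous (dr t x).
have cv t : continuous (v t) by move=> x; exact: is_derive_continuous (dv t x).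
have vE t : 0 < t < T' -> v t = u t.
  move=> tI; have [rv _] := reprv t (I t tI).
  apply: ae_eq_continuous => //.
    by apply: derivable_continuous => y; have [[_ _ _ _]] := sol t y (IT t tI).
  by have [_ _ H] := rv; apply: ae_imply H.
have rvE t : 0 < t < T' -> (fun y => rho t y * u t y) = (fun y => r t y * v t y).
  move=> tI; apply: ae_eq_continuous.
  - by apply: derivable_continuous => y; have [[_ H _ _ _] _] := sol t y (IT t tI).
  - by move=> y; apply: cvgM; [exact: cr|exact: cv].
  - have [_ _ H] := reprr t (I t tI); apply: ae_imply H => y ->.
    by rewrite (vE t tI).
have d_rv t (x : R) : is_derive x 1 (fun y => r t y * v t y) (rx t x * v t x + r t x * vx t x).
  exact: is_derive_mulf.
have conteq t x : 0 < t < T' -> rt t x + v t x * rx t x + r t x * vx t x = 0.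
  move=> tI.
  have -> : rt t x + v t x * rx t x + r t x * vx t x =
    (rt t x + (rx t x * v t x + r t x * vx t x)) by ring.
  suff -> : rt t = (fun x => - (rx t x * v t x + r t x * vx t x)).
    by rewrite addNr.
  have [_ crx _] := reprr t (I t tI); have [[_ cvx _] _] := reprv t (I t tI).
  apply: ae_eq_continuous; first exact: crt (I t tI).
    move=> y; apply: cvgN; apply: cvgD; apply: cvgM.
    - exact: crx.
    - exact: cv.
    - exact: cr.
    - exact: cvx.
  have /andP[t0 tT] := tI.
  (* [rho s] equals [r s] only almost everywhere, so the time derivatives at [t]
     are compared along a sequence of times, off a countable union of null sets. *)
  pose d := (T' - t) / 2.
  have d0 : 0 < d by rewrite divr_gt0// subr_gt0.
  have sI n : 0 < t + d / n.+1%:R < T'.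
    have dn : d / n.+1%:R <= d by rewrite ler_pdivrMr// ler_peMr ?(ltW d0)// ler1n.
    have dn0 : 0 < d / n.+1%:R by rewrite divr_gt0.
    have dT : t + d < T' by rewrite /d; lra.
    by rewrite addr_gt0//= (le_lt_trans _ dT)// lerD2l.
  have H1 : {ae mu, forall x, rho t x = r t x} by have [] := reprr t (I t tI).
  have H2 : {ae mu, forall x, forall n : nat,
      rho (t + d / n.+1%:R) x = r (t + d / n.+1%:R) x}.
    by apply: ae_foralln => n; have [] := reprr _ (I _ (sI n)).
  apply: ae_imply (ae_and H1 H2) => y [e1 e2].
  have [[drho _ _ _ _] [_ eq1 _]] := sol t y (IT t tI).
  have E := is_derive_eq_along d0 (derivable_is_derive drho) (field_dt y fr tI) e1 e2.
  rewrite -E; move: eq1; rewrite (rvE t tI) (is_derive_derive1 (d_rv t y)) => /eqP.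
  by rewrite addr_eq0 => /eqP.
exists r, rx, rt, v, vx, vt, B, T'; split => //; split => //.
- move=> rge0 t x tI.
  have rge0' y : 0 <= r t y by apply: rge0; have /andP[/ltW -> ->] := tI.
  have [_ [duxx _ eq2]] := sol t x (IT t tI).
  have cp := powR_comp_continuous g1 (cr t) rge0'.
  have d_rvv (y : R) : is_derive y 1 (fun y => r t y * v t y * v t y)
     ((rx t y * v t y + r t y * vx t y) * v t y + r t y * v t y * vx t y).
    exact: is_derive_mulf.
  have rvvE : (fun y => rho t y * u t y ^+ 2) = (fun y => r t y * v t y * v t y).
    apply/funext => y; have := congr1 (fun f => f y) (rvE t tI) => /= <-.
    by rewrite (vE t tI) expr2 mulrA.
  have fluxE : (fun y => rho t y * u t y ^+ 2 + rho t y `^ gamma) =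
    (fun y => r t y * v t y * v t y + r t y `^ gamma).
    apply: ae_eq_continuous.
    + by apply: derivable_continuous => y; have [[_ _ _ H _] _] := sol t y (IT t tI).
    + move=> y; apply: cvgD; last exact: cp.
      exact: is_derive_continuous (d_rvv y).
    + have [_ _ H] := reprr t (I t tI); apply: ae_imply H => y H.
      by have := congr1 (fun f => f y) rvvE => /= ->; rewrite H.
  have [[_ _ _ dflux _] _] := sol t x (IT t tI).
  rewrite fluxE in dflux eq2.
  (* Derivability is known only for the total flux; subtracting its differentiable part [r v^2]
     isolates the pressure. *)
  have dp : is_derive x 1 (fun y => r t y `^ gamma)
     (derive1 (fun y => r t y * v t y * v t y + r t y `^ gamma) x -
      ((rx t x * v t x + r t x * vx t x) * v t x + r t x * v t x * vx t x)).
    have := is_derive_subf (derivable_is_derive dflux) (d_rvv x).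
    rewrite (_ : (fun y => _ - _) = (fun y => r t y `^ gamma))//.
    by apply/funext => y; rewrite addrC addKr.
  have uxE : derive1 (u t) = vx t.
    by apply/funext => y; rewrite -(vE t tI); exact: is_derive_derive1.
  rewrite uxE in duxx eq2.
  split; [by case: dp|exact: duxx|].
  rewrite (is_derive_derive1 dp) -eq2.
  have dtrv : is_derive t 1 (fun s => r s x * v s x) (rt t x * v t x + r t x * vt t x).
    by apply: is_derive_mulf; [exact: field_dt fr tI|exact: field_dt fv tI].
  have -> : derive1 (fun s => rho s x * u s x) t = rt t x * v t x + r t x * vt t x.
    apply: is_derive_derive1; apply: near_eq_is_derive dtrv.
    have /andP[t0 tT] := tI.
    near=> s; have sI : 0 < s < T'.
      by apply/andP; split; near: s; [exact: lt_nbhsr|exact: lt_nbhsl].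
    by have := congr1 (fun f => f x) (rvE s sI) => /= ->.
  (* The continuity equation turns the conservative form of the momentum equation into the
     nonconservative one. *)
  have -> : rt t x = - (v t x * rx t x + r t x * vx t x).
    by apply/eqP; rewrite -addr_eq0 addrA conteq.
  ring.
- by move=> t a c tI; have [_ v2] := reprv t (I t tI); exact: L2_constant_half_line.
- by move=> x; rewrite rE0.
- by move=> x x01; rewrite rE0; exact: rho0_out.
Unshelve. all: by end_near. Qed.

Lemma le0_left_endpoint (f : R -> R) (L : R) : continuous f -> 0 < L ->
  (forall x, 0 < x < L -> f x <= 0) -> f 0 <= 0.
Proof.
move=> cf L0 fL; rewrite leNgt; apply/negP => f0.
have [e /= e0 He] := cvgr_gt _ (cf 0) _ f0.
pose h := Num.min e L / 2.
have m0 : 0 < Num.min e L by rewrite lt_min e0.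
have h0 : 0 < h by rewrite divr_gt0.
have : h < Num.min e L by rewrite ltr_pdivrMr// ltr_pMr// ltr1n.
rewrite lt_min => /andP[he hL].
have : 0 < f h by apply: He; rewrite /ball/= sub0r normrN gtr0_norm.
by rewrite ltNge fL// h0.
Qed.

Lemma flow_contradiction r rx rt u ux ut (B T nu gamma lam L : R) :
  flow r rx rt u ux ut B T nu gamma ->
  0 < nu -> 1 < gamma -> 0 < T -> 0 < L -> 0 < lam ->
  (forall x, 0 < x < L -> 0 < r 0 x) ->
  (forall x, 0 < x < L -> derivable (r 0) x 1 /\ lam <= derive1 (r 0) x / r 0 x) ->
  u 0 L < 0 -> (forall x, 0 < x < L -> u 0 x <= 0) -> False.
Proof.
case=> fr fu cont mom decay ge0 vac nu0 g1 T0 L0 lam0 rpos rlam uL u0.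
have cr : continuous (r 0) by move=> x; exact: is_derive_continuous (field_dx fr 0 x).
have cu : continuous (u 0) by move=> x; exact: is_derive_continuous (field_dx fu 0 x).
apply: (no_flow nu0 g1 fr fu cont mom _ ge0 _ T0 L0 lam0 _ uL).
- by move=> t a c tI H; apply: (decay t a c tI); left.
- by move=> x x0; apply: vac; left.
- by apply: log_derivative_growth => //; apply: vac; left.
- move=> x /andP[]; rewrite le_eqVlt => /orP[/eqP <- _|x0].
    exact: le0_left_endpoint cu L0 u0.
  rewrite le_eqVlt => /orP[/eqP ->|xL]; first exact: ltW.
  by apply: u0; rewrite x0.
Qed.

(** The closed support contains both endpoints, but the density vanishes there as a limit of its
    values outside [[0, 1]]. *)
Lemma support_unit_itv (f : R -> R) : continuous f ->
  closure [set x | f x != 0] = [set x : R | 0 <= x <= 1] ->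
  forall x, x <= 0 \/ 1 <= x -> f x = 0.
Proof.
move=> cf supp.
have out x : x < 0 \/ 1 < x -> f x = 0.
  move=> xI; apply/eqP; apply: contrapT => /negP fx.
  have : [set x : R | 0 <= x <= 1] x by rewrite -supp; exact: subset_closure.
  by move=> /= /andP[]; case: xI; lra.
have edge (x s : R) : (forall h, 0 < h -> f (x + s * h) = 0) -> `|s| = 1 -> f x = 0.
  move=> fs s1; apply/eqP; apply: contrapT => /negP fx.
  have [e /= e0 He] := cvgr_neq0 _ (cf x) fx.
  have e2 : 0 < e / 2 by rewrite divr_gt0.
  have : f (x + s * (e / 2)) != 0.
    apply: He; rewrite /ball/= opprD addNKr normrN normrM s1 mul1r gtr0_norm//.
    by rewrite ltr_pdivrMr// ltr_pMr// ltr1n.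
  by rewrite fs// eqxx.
move=> x [|]; rewrite le_eqVlt => /orP[/eqP|] xE.
- by apply: (edge x (-1)); [move=> h h0; apply: out; left; rewrite xE; lra|rewrite normrN1].
- by apply: out; left.
- by apply: (edge x 1); [move=> h h0; apply: out; right; rewrite -xE; lra|rewrite normr1].
- by apply: out; right.
Qed.

End Bridge.

Theorem theorem1p1 (R : realType) (mu lam gamma : R) (rho0 u0 : R -> R) :
  0 < mu -> 0 < 2 * mu + lam -> 1 < gamma ->
  continuous rho0 -> continuous u0 ->
  closure [set x | rho0 x != 0] = [set x : R | 0 <= x <= 1] ->
  (forall x : R, 0 < x < 1 -> 0 < rho0 x) ->
  (exists l1 l2 l3 l4 : R,
     [/\ 0 < l1, 0 < l2, 0 < l3 < 1 & 0 < l4 < 1] /\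
     ((  (forall x : R, 0 < x < l3 ->
            derivable rho0 x 1 /\ l1 <= derive1 rho0 x / rho0 x)
       /\ u0 l3 < 0
       /\ (forall x : R, 0 < x < l3 -> u0 x <= 0))
      \/
      (  (forall x : R, l4 < x < 1 ->
            derivable rho0 x 1 /\ derive1 rho0 x / rho0 x <= - l2)
       /\ 0 < u0 l4
       /\ (forall x : R, l4 < x < 1 -> 0 <= u0 x)))) ->
  forall T m : R, 0 < T -> 2 < m ->
  ~ exists rho u : R -> R -> R,
      [/\ C1_Hm m T rho, C1_Hm m T u &
          CNS_solution (2 * mu + lam) gamma T rho0 u0 rho u].
Proof.
move=> _ nu0 g1 crho0 cu0 supp rho0pos [l1 [l2 [l3 [l4]]]].
move=> [[l10 l20 /andP[l30 l31] /andP[l40 l41]] cond] T m T0 m2.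
move=> [rho [u [Crho Cu sol]]].
have vac := support_unit_itv crho0 supp.
have rho0_ge0 x : 0 <= rho0 x.
  have [x0|x0] := leP x 0; first by rewrite vac//; left.
  have [x1|x1] := leP 1 x; first by rewrite vac//; right.
  by rewrite ltW// rho0pos// x0.
have [r [rx [rt [v [vx [vt [B [T' [T'0 fl rE vE]]]]]]]]] :=
  CNS_flow g1 m2 T0 crho0 cu0 rho0_ge0 vac Crho Cu sol.
case: cond => [[rlam [uL u0le]]|[rlam [uL u0ge]]].
  apply: (flow_contradiction fl nu0 g1 T'0 l30 l10); rewrite ?rE ?vE//.
  by move=> x /andP[x0 xl]; rewrite rho0pos// x0 (lt_trans xl).
have L0 : 0 < 1 - l4 by rewrite subr_gt0.
have xI x : 0 < x < 1 - l4 -> l4 < 1 - x < 1 by move=> /andP[? ?]; apply/andP; split; lra.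
(* In the reflected variable [(l4, 1)] becomes [(0, 1 - l4)], and the logarithmic derivative changes
   sign, so [l2] is the growth rate. *)
apply: (flow_contradiction (flow_reflect fl) nu0 g1 T'0 L0 l20);
  rewrite /= ?rE ?vE.
- move=> x /xI/andP[xl x1]; rewrite rho0pos// x1 andbT; exact: lt_trans xl.
- move=> x /xI xl; have [dr dl] := rlam _ xl.
  have H := is_derive_reflect (derivable_is_derive dr).
  split; first by case: H.
  by rewrite (is_derive_derive1 H) mulNr lerNr.
- by rewrite subKr oppr_lt0.
- by move=> x /xI/u0ge; rewrite oppr_le0.
Qed.
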